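(* Let $\nu\in(0,1)$. For $p\ge1$ put $$a_p^\pm=\frac{(-1)^p}{p!}\sum_{k\in\mathbb Z}\Big((\lambda_k^\pm(\nu))^p-|k-\nu|^p\Big).$$ Then for all $t\in(0,2)$, $$\mathrm{Tr}\,(e^{-t\Lambda_\nu})=2\,\frac{\cosh\big(t(\nu-\frac12)\big)}{\sinh(t/2)}+\sum_{p\ge1}(a_p^++a_p^-)\,t^p .$$ In particular, as $t\to0^+$, $$\mathrm{Tr}\,(e^{-t\Lambda_\nu})=\frac4t+2\Big(\frac16-\nu+\nu^2-\breve a_1(\nu)\Big)t+\mathcal O(t^2),\qquad \breve a_1(\nu)=\sum_{k\in\mathbb Z}|k-\nu|\big(\coth(2|k-\nu|)-1\big).$$
   Context: On the cylinder $M=(-1,1)\times S^1$ with coordinates $(x,\theta)$, $S^1=\mathbb R/2\pi\mathbb Z$, consider the magnetic Laplacian $$H_\nu=-\frac{\partial^2}{\partial x^2}+\Big(\frac1i\frac{\partial}{\partial\theta}-\nu\Big)^2 .$$ $\Lambda_\nu$ is the associated Dirichlet-to-Neumann operator on $\partial M=\{-1,1\}\times S^1$: it maps boundary data $f$ to the outward normal derivative on $\partial M$ of the solution $u$ of $H_\nu u=0$ in $M$, $u=f$ on $\partial M$. Its spectrum (with multiplicity) is $\{\lambda_k^+(\nu)\}_{k\in\mathbb Z}\cup\{\lambda_k^-(\nu)\}_{k\in\mathbb Z}$ with $$\lambda_k^+(\nu)=(k-\nu)\coth(k-\nu),\qquad \lambda_k^-(\nu)=(k-\nu)\tanh(k-\nu).$$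 *)

(* Defs.v *)
From Stdlib Require Import Reals ZArith.
From Coquelicot Require Import Coquelicot.
Open Scope R_scope.

Definition ex_dC (f : R -> C) (x : R) : Prop :=
  ex_derive (fun y => Re (f y)) x /\ ex_derive (fun y => Im (f y)) x.

Definition dC (f : R -> C) (x : R) : C :=
  (Derive (fun y => Re (f y)) x, Derive (fun y => Im (f y)) x).

Definition d_x (u : R -> R -> C) : R -> R -> C :=
  fun x th => dC (fun y => u y th) x.

Definition d_th (u : R -> R -> C) : R -> R -> C :=
  fun x th => dC (fun y => u x y) th.

Fixpoint class_C (n : nat) (u : R -> R -> C) : Prop :=
  (forall p : R * R, continuous (fun q : R * R => u (fst q) (snd q)) p) /\
  match n with
  | O => True
  | S m =>
      (forall x th, ex_dC (fun y => u y th) x /\ ex_dC (fun y => u x y) th) /\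
      class_C m (d_x u) /\ class_C m (d_th u)
  end.

Definition smooth (u : R -> R -> C) : Prop := forall n, class_C n u.

(* (1/i) d/dtheta - nu *)
Definition magnetic_d (nu : R) (u : R -> R -> C) : R -> R -> C :=
  fun x th => (/ Ci * d_th u x th - RtoC nu * u x th)%C.

Definition magnetic_laplacian (nu : R) (u : R -> R -> C) : R -> R -> C :=
  fun x th => (- d_x (d_x u) x th + magnetic_d nu (magnetic_d nu u) x th)%C.

(* A function on the boundary {-1,1} x S^1 is a 2 pi-periodic function of theta
   on each component; [true] labels x = 1 and [false] labels x = -1.
   [side s] is both the abscissa of the component [s] and the x-component of
   the outward unit normal there. *)
Definition bfun : Type := bool -> R -> C.

Definition side (s : bool) : R := if s then 1 else -1.

Definition smooth_bfun (f : bfun) : Prop :=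
  forall s,
    (forall th, f s (th + 2 * PI) = f s th) /\
    (forall n th, ex_derive_n (fun y => Re (f s y)) n th /\
                  ex_derive_n (fun y => Im (f s y)) n th).

(* [DN nu f g] : [g] is the image of [f] under the Dirichlet-to-Neumann operator,
   on the core of smooth functions.  A function smooth up to the boundary of
   M = (-1,1) x S^1 is represented by a smooth extension to R x S^1, on which
   the equation is only imposed inside M; the Dirichlet and Neumann data do not
   depend on the extension. *)
Definition DN (nu : R) (f g : bfun) : Prop :=
  exists u : R -> R -> C,
    smooth u /\
    (forall x th, u x (th + 2 * PI) = u x th) /\
    (forall x th, -1 < x < 1 -> magnetic_laplacian nu u x th = RtoC 0) /\
    (forall s th, u (side s) th = f s th) /\
    (forall s th, g s th = (RtoC (side s) * d_x u (side s) th)%C).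

(* Inner product of L^2({-1,1} x S^1, dtheta), linear on the left. *)
Definition inner (f g : bfun) : C :=
  (RInt (V := C_R_CompleteNormedModule)
     (fun th => f true th * Cconj (g true th))%C 0 (2 * PI) +
   RInt (V := C_R_CompleteNormedModule)
     (fun th => f false th * Cconj (g false th))%C 0 (2 * PI))%C.

(* [phi] is a Hilbert basis of L^2 of the boundary made of eigenfunctions of the
   Dirichlet-to-Neumann operator, with eigenvalues [lam] (thus repeated
   according to multiplicity).  Completeness is Parseval's identity on the
   smooth functions, which are dense in L^2. *)
Definition eigenbasis (nu : R) (lam : nat -> R) (phi : nat -> bfun) : Prop :=
  (forall n, DN nu (phi n) (fun s th => RtoC (lam n) * phi n s th)%C) /\
  (forall m n, inner (phi m) (phi n) = RtoC (if Nat.eqb m n then 1 else 0)) /\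
  (forall f, smooth_bfun f ->
     is_series (fun n => Cmod (inner f (phi n)) ^ 2) (Re (inner f f))).

(* By functional calculus exp(-t Lambda) phi_n = exp(-t lam_n) phi_n, hence
   Tr exp(-t Lambda) = sum_n <exp(-t Lambda) phi_n, phi_n> = sum_n exp(-t lam_n).
   The sum is required to converge to [T] in every eigenbasis, and an eigenbasis
   is required to exist. *)
Definition is_heat_trace (nu t T : R) : Prop :=
  (exists lam phi, eigenbasis nu lam phi) /\
  (forall lam phi, eigenbasis nu lam phi ->
     is_series (fun n => exp (- t * lam n)) T).

Definition coth (x : R) : R := cosh x / sinh x.

Definition lambda_plus (nu : R) (k : Z) : R := (IZR k - nu) * coth (IZR k - nu).
Definition lambda_minus (nu : R) (k : Z) : R := (IZR k - nu) * tanh (IZR k - nu).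

(* Sums over Z, split as k >= 0 and k <= -1. *)
Definition ex_series_Z (a : Z -> R) : Prop :=
  ex_series (fun n => a (Z.of_nat n)) /\
  ex_series (fun n => a (- Z.of_nat (S n))%Z).

Definition Series_Z (a : Z -> R) : R :=
  Series (fun n => a (Z.of_nat n)) + Series (fun n => a (- Z.of_nat (S n))%Z).

Definition a_term (lambda : R -> Z -> R) (nu : R) (p : nat) (k : Z) : R :=
  lambda nu k ^ p - Rabs (IZR k - nu) ^ p.

Definition a_coef (lambda : R -> Z -> R) (nu : R) (p : nat) : R :=
  (-1) ^ p / INR (fact p) * Series_Z (a_term lambda nu p).

Definition a_plus : R -> nat -> R := a_coef lambda_plus.
Definition a_minus : R -> nat -> R := a_coef lambda_minus.

Definition breve_term (nu : R) (k : Z) : R :=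
  Rabs (IZR k - nu) * (coth (2 * Rabs (IZR k - nu)) - 1).

Definition a1_breve (nu : R) : R := Series_Z (breve_term nu).

(* Main.v *)
Require Import Defs.
From Stdlib Require Import Reals ZArith Lra Lia FunctionalExtensionality.
From Coquelicot Require Import Coquelicot.
Open Scope R_scope.

(** Separation of variables gives the orthonormal eigenfunctions
    [(side s) e^{ik theta} / sqrt (4 pi)] and [e^{ik theta} / sqrt (4 pi)], with eigenvalues
    [lambda_plus nu k] and [lambda_minus nu k].  Completeness: with F_n the (unnormalised) Fejer
    kernel, [(1 - cos d) F_n d = 1 - cos (n d)], so for a smooth periodic [f] the integrand
    [|f x - f y|^2 F_n (x - y)] is bounded uniformly in [n]; its double integral is
    a multiple of the sum over [m < n] of the defects in Bessel's inequality at order [m],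
    which decrease with [m] and therefore tend to 0.  In an arbitrary eigenbasis [phi], the Wronskian
    of the k-th Fourier coefficient with cosh or sinh shows that [phi n] is orthogonal to
    every explicit eigenfunction with another eigenvalue, so expanding [phi] in the explicit
    basis and conversely gives the same heat trace.  Finally
    [sum_k e^{-t |k - nu|} = cosh (t (nu - 1/2)) / sinh (t/2)], and
    [sum_k (e^{-t lambda} - e^{-t |k - nu|})] is expanded in powers of [t]: the double series
    converges absolutely because [lambda - |k - nu| = O (|k - nu| e^{-2 |k - nu|})], whence
    the bound [t < 2]. *)

(** * Double series *)

(** No self-adjointness of the Dirichlet-to-Neumann operator and no spectral theorem is established:
    [DN] is a relation on smooth data. What symmetry would provide, orthogonality between different
    eigenvalues, comes from an ODE computation against the explicit modes e_j only. This suffices: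
    in the double sum of e^{-t mu_j} |<phi_n, e_j>|^2 the eigenvalue mu_j may be replaced by lam_n
    wherever the coefficient is nonzero, so by Parseval in either basis the column sums and the row
    sums are the terms of the two heat sums. All terms are nonnegative, so convergence of the
    unknown trace is obtained along with its value. The threshold 2 has an exact origin. For x, y >=
    0 the numbers x^p - y^p never change sign as p varies, so the absolute values in the expansion
    of e^{-tx} - e^{-ty} add up to |e^{tx} - e^{ty}|, with the sign of t reversed. The growth e^{t
    |k - nu|} then competes with the gap e^{-2 |k - nu|}. The hypothesis 0 < nu < 1 keeps k - nu
    away from 0, where [coth] and the odd solution sinh ((k - nu) x) would degenerate. *)

Lemma is_series_le (a b : nat -> R) (la lb : R) :
  (forall n, a n <= b n) -> is_series a la -> is_series b lb -> la <= lb.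
Proof.
  intros H Ha Hb.
  apply (is_lim_seq_le (sum_n a) (sum_n b) la lb).
  - intro n. rewrite !sum_n_Reals. apply sum_Rle. intros; apply H.
  - exact Ha.
  - exact Hb.
Qed.

Lemma sum_n_nonneg_incr (a : nat -> R) :
  (forall n, 0 <= a n) -> forall n, sum_n a n <= sum_n a (S n).
Proof.
  intros H n. rewrite sum_Sn. unfold plus; simpl. specialize (H (S n)). lra.
Qed.

Lemma sum_n_le_series (a : nat -> R) (l : R) (N : nat) :
  (forall n, 0 <= a n) -> is_series a l -> sum_n a N <= l.
Proof.
  intros H Ha.
  apply (is_lim_seq_incr_compare (sum_n a) l Ha (sum_n_nonneg_incr a H)).
Qed.

Lemma is_series_sum_n (a : nat -> nat -> R) (l : nat -> R) (N : nat) :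
  (forall n, is_series (a n) (l n)) ->
  is_series (fun j => sum_n (fun n => a n j) N) (sum_n l N).
Proof.
  intros H. induction N as [|N IH].
  - rewrite sum_O. apply is_series_ext with (a 0%nat); [|apply H].
    intro j. now rewrite sum_O.
  - rewrite sum_Sn.
    apply is_series_ext with (fun j => plus (sum_n (fun n => a n j) N) (a (S N) j)).
    + intro j. now rewrite sum_Sn.
    + exact (is_series_plus _ _ _ _ IH (H (S N))).
Qed.

(** Tonelli: finite blocks of rows are dominated by the column totals, and finite blocks of columns
    by the row totals. Convergence of the row totals [r] is part of the conclusion, which is what
    makes the lemma applicable to an eigenbasis about whose eigenvalues nothing is known. *)
Lemma is_series_nonneg_swap (a : nat -> nat -> R) (c r : nat -> R) (T : R) :
  (forall n j, 0 <= a n j) ->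
  (forall j, is_series (fun n => a n j) (c j)) ->
  is_series c T ->
  (forall n, is_series (a n) (r n)) ->
  is_series r T.
Proof.
  intros Ha Hc HT Hr.
  assert (r_pos : forall n, 0 <= r n).
  { intro n. apply Rle_trans with (sum_n (a n) 0).
    - rewrite sum_O. apply Ha.
    - apply sum_n_le_series; auto. }
  assert (HU : forall N, sum_n r N <= T).
  { intro N. apply (is_series_le (fun j => sum_n (fun n => a n j) N) c).
    - intro j. apply sum_n_le_series; auto.
    - apply is_series_sum_n; auto.
    - exact HT. }
  destruct (ex_finite_lim_seq_incr (sum_n r) T (sum_n_nonneg_incr r r_pos) HU)
    as [l Hl].
  assert (Hl1 : l <= T).
  { apply (is_lim_seq_le (sum_n r) (fun _ => T) l T HU Hl (is_lim_seq_const T)). }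
  assert (Hl2 : T <= l).
  { apply (is_lim_seq_le (sum_n c) (fun _ => l) T l).
    - intro J. apply (is_series_le (fun n => sum_n (a n) J) r).
      + intro n. apply sum_n_le_series; auto.
      + apply (is_series_sum_n (fun j n => a n j) c J); auto.
      + exact Hl.
    - exact HT.
    - apply is_lim_seq_const. }
  replace T with l by lra. exact Hl.
Qed.

Lemma ex_series_col (a : nat -> nat -> R) (r : nat -> R) :
  (forall n j, 0 <= a n j) ->
  (forall n, is_series (a n) (r n)) -> ex_series r ->
  forall j, ex_series (fun n => a n j).
Proof.
  intros Ha Hr Hs j.
  apply (ex_series_le (V := R_CompleteNormedModule) (fun n => a n j) r); auto.
  intro n. change (norm (a n j)) with (Rabs (a n j)).
  rewrite Rabs_pos_eq by apply Ha.
  apply Rle_trans with (sum_n (a n) j).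
  - destruct j; [rewrite sum_O; lra|].
    rewrite sum_Sn. unfold plus; simpl.
    assert (0 <= sum_n (a n) j); [|lra].
    rewrite sum_n_Reals. apply cond_pos_sum; auto.
  - apply sum_n_le_series; auto.
Qed.

Lemma nonneg_fubini (a : nat -> nat -> R) (r : nat -> R) :
  (forall n j, 0 <= a n j) ->
  (forall n, is_series (a n) (r n)) -> ex_series r ->
  is_series (fun j => Series (fun n => a n j)) (Series r).
Proof.
  intros Ha Hr Hs.
  apply (is_series_nonneg_swap (fun j n => a n j) r).
  - auto.
  - exact Hr.
  - now apply Series_correct.
  - intro j. apply Series_correct. now apply ex_series_col with r.
Qed.

Lemma abs_fubini (a : nat -> nat -> R) (rho r : nat -> R) :
  (forall n, is_series (fun p => Rabs (a n p)) (rho n)) -> ex_series rho ->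
  (forall n, is_series (a n) (r n)) ->
  (forall p, ex_series (fun n => Rabs (a n p))) /\
  ex_series (fun p => Series (fun n => Rabs (a n p))) /\
  ex_series r /\
  is_series (fun p => Series (fun n => a n p)) (Series r).
Proof.
  intros Hrho Hs Hr.
  assert (Habs : forall p, ex_series (fun n => Rabs (a n p))).
  { intro p. apply (ex_series_col (fun n p => Rabs (a n p)) rho); auto.
    intros; apply Rabs_pos. }
  assert (Hrle : forall n, Rabs (r n) <= rho n).
  { intro n. rewrite <- (is_series_unique _ _ (Hr n)), <- (is_series_unique _ _ (Hrho n)).
    apply Series_Rabs. exists (rho n). apply Hrho. }
  assert (Hexr : ex_series r).
  { apply (ex_series_le (V := R_CompleteNormedModule) r rho); auto. }
  assert (H1 := nonneg_fubini (fun n p => Rabs (a n p)) rho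
                  (fun n p => Rabs_pos _) Hrho Hs).
  (* Writing a = (|a| + a) - |a| reduces the signed case to two nonnegative double series. *)
  assert (H2 : is_series (fun p => Series (fun n => Rabs (a n p) + a n p))
                 (Series (fun n => rho n + r n))).
  { apply (nonneg_fubini (fun n p => Rabs (a n p) + a n p) (fun n => rho n + r n)).
    - intros n p. generalize (Rle_abs (- a n p)). rewrite Rabs_Ropp. lra.
    - intro n. apply (is_series_plus (fun p => Rabs (a n p)) (a n)); auto.
    - apply (ex_series_plus rho r); auto. }
  repeat split; auto.
  - eexists; exact H1.
  - replace (Series r) with (Series (fun n => rho n + r n) - Series rho)
      by (rewrite Series_plus; auto; ring).
    eapply is_series_ext; [|apply (is_series_minus _ _ _ _ H2 H1)].
    intro p. cbv beta. unfold plus, opp; simpl.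
    rewrite Series_plus; auto.
    + ring.
    + now apply ex_series_Rabs.
Qed.

Lemma is_series_exp (x : R) : is_series (fun p => x ^ p / INR (fact p)) (exp x).
Proof.
  eapply is_series_ext; [|apply (is_exp_Reals x)].
  intro n. unfold scal; simpl. unfold mult; simpl. rewrite pow_n_pow.
  unfold Rdiv. ring.
Qed.

Lemma is_series_exp_sub (t x y : R) :
  is_series (fun p => t ^ p / INR (fact p) * (x ^ p - y ^ p))
    (exp (t * x) - exp (t * y)).
Proof.
  eapply is_series_ext;
    [|apply (is_series_minus _ _ _ _ (is_series_exp (t * x)) (is_series_exp (t * y)))].
  intro n. cbv beta. unfold plus, opp; simpl. rewrite !Rpow_mult_distr.
  unfold Rdiv. ring.
Qed.

(** For nonnegative x and y the sign of x^p - y^p does not depend on p, so the absolute values can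
    be taken outside the sum; they also turn (-t)^p into t^p. *)
Lemma is_series_exp_sub_Rabs (t x y : R) : 0 <= t -> 0 <= x -> 0 <= y ->
  is_series (fun p => Rabs ((- t) ^ p / INR (fact p) * (x ^ p - y ^ p)))
    (Rabs (exp (t * x) - exp (t * y))).
Proof.
  intros Ht.
  assert (Habs : forall p z, Rabs ((- t) ^ p / INR (fact p) * z)
                   = t ^ p / INR (fact p) * Rabs z).
  { intros p z. unfold Rdiv. rewrite !Rabs_mult, <- RPow_abs, Rabs_Ropp.
    rewrite (Rabs_pos_eq t Ht), (Rabs_pos_eq (/ _)); auto.
    left. apply Rinv_0_lt_compat, INR_fact_lt_0. }
  assert (Hwlog : forall x y, 0 <= y <= x ->
    is_series (fun p => Rabs ((- t) ^ p / INR (fact p) * (x ^ p - y ^ p)))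
      (Rabs (exp (t * x) - exp (t * y)))).
  { intros u v Huv.
    rewrite Rabs_pos_eq.
    - eapply is_series_ext; [|apply is_series_exp_sub].
      intro p. rewrite Habs, (Rabs_pos_eq (_ - _)); auto.
      generalize (pow_incr v u p Huv). lra.
    - assert (exp (t * v) <= exp (t * u)); [|lra].
      destruct (Req_dec (t * v) (t * u)) as [->|]; [lra|].
      left. apply exp_increasing. generalize (Rmult_le_compat_l t v u Ht). lra. }
  intros Hx Hy. destruct (Rle_or_lt y x) as [H|H].
  - apply Hwlog; lra.
  - rewrite Rabs_minus_sym. eapply is_series_ext; [|apply (Hwlog y x); lra].
    intro p. rewrite !Habs. now rewrite Rabs_minus_sym.
Qed.

(** Both exponentials are expanded and the sums over n and p exchanged. The summability assumption
    with +t is the sum of the absolute values of the double series. *)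
Lemma exp_diff_power_series (t : R) (lam m : nat -> R) : 0 < t ->
  (forall n, 0 <= lam n) -> (forall n, 0 <= m n) ->
  ex_series (fun n => Rabs (exp (t * lam n) - exp (t * m n))) ->
  (forall p, ex_series (fun n => lam n ^ p - m n ^ p)) /\
  ex_series (fun n => exp (- t * lam n) - exp (- t * m n)) /\
  ex_series (fun p => Rabs ((-1) ^ p / INR (fact p)
                * Series (fun n => lam n ^ p - m n ^ p) * t ^ p)) /\
  is_series (fun p => (-1) ^ p / INR (fact p)
                * Series (fun n => lam n ^ p - m n ^ p) * t ^ p)
    (Series (fun n => exp (- t * lam n) - exp (- t * m n))).
Proof.
  intros Ht Hlam Hm Hs.
  set (a := fun n p => (- t) ^ p / INR (fact p) * (lam n ^ p - m n ^ p)).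
  destruct (abs_fubini a (fun n => Rabs (exp (t * lam n) - exp (t * m n)))
              (fun n => exp (- t * lam n) - exp (- t * m n))) as [H1 [H2 [H3 H4]]].
  - intro n. apply is_series_exp_sub_Rabs; auto. lra.
  - exact Hs.
  - intro n. apply is_series_exp_sub.
  (* Each column of the double series carries a nonzero factor; dividing by it gives the summability
     of the differences of p-th powers themselves. *)
  - assert (Hnz : forall p, (- t) ^ p / INR (fact p) <> 0).
    { intro p. apply Rmult_integral_contrapositive. split.
      - apply pow_nonzero. lra.
      - apply Rinv_neq_0_compat, INR_fact_neq_0. }
    assert (Hcoef : forall p, Series (fun n => a n p) =
      (-1) ^ p / INR (fact p) * Series (fun n => lam n ^ p - m n ^ p) * t ^ p).
    { intro p. unfold a. rewrite Series_scal_l.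
      replace (- t) with (-1 * t) by ring. rewrite Rpow_mult_distr.
      unfold Rdiv; ring. }
    repeat split.
    + intro p.
      apply ex_series_ext with (fun n => scal (/ ((- t) ^ p / INR (fact p))) (a n p)).
      * intro n. unfold scal, a; simpl. unfold mult; simpl.
        rewrite <- Rmult_assoc, Rinv_l, Rmult_1_l; auto.
      * apply (ex_series_scal (V := R_NormedModule)). now apply ex_series_Rabs.
    + exact H3.
    + apply (ex_series_le (V := R_CompleteNormedModule) _ _) with (2 := H2).
      intro p. rewrite <- Hcoef.
      change (norm ?x) with (Rabs x). rewrite Rabs_Rabsolu.
      now apply Series_Rabs.
    + eapply is_series_ext; [|exact H4]. exact Hcoef.
Qed.

(** * Even and odd indices, enumeration of the integers *)

Lemma is_series_even_odd (a : nat -> R) (l1 l2 : R) :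
  is_series (fun n => a (2 * n)%nat) l1 ->
  is_series (fun n => a (2 * n + 1)%nat) l2 ->
  is_series a (l1 + l2).
Proof.
  intros H1 H2.
  assert (E : forall (b : nat -> R) (l : R), is_series b l <-> is_pseries b 1 l).
  { intros b l.
    assert (Hb : forall n, scal (pow_n (K := R_AbsRing) 1 n) (b n) = b n).
    { intro n. unfold scal; simpl. unfold mult; simpl.
      rewrite pow_n_pow, pow1. ring. }
    split; apply is_series_ext; intro n; now rewrite Hb. }
  (* The splitting of a power series into its even and odd parts, evaluated at the point 1. *)
  apply (proj2 (E _ _)). replace (l1 + l2) with (l1 + 1 * l2) by ring.
  apply is_pseries_odd_even; replace (1 ^ 2) with 1 by ring; apply (proj1 (E _ _)); assumption.
Qed.

(** The order 0, -1, 1, -2, 2, ...: the indices 0 to 2n run exactly through the integers with |k| <=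
    n, so symmetric partial sums are the partial sums of even index. *)
Definition int_enum (n : nat) : Z :=
  if Nat.even n then Z.of_nat (Nat.div2 n) else (- Z.of_nat (S (Nat.div2 n)))%Z.

Lemma int_enum_even (n : nat) : int_enum (2 * n) = Z.of_nat n.
Proof. unfold int_enum. now rewrite Nat.even_even, Nat.div2_even. Qed.

Lemma int_enum_odd (n : nat) : int_enum (2 * n + 1) = (- Z.of_nat (S n))%Z.
Proof. unfold int_enum. now rewrite Nat.even_odd, Nat.div2_odd'. Qed.

Lemma int_enum_inj (m n : nat) : int_enum m = int_enum n -> m = n.
Proof.
  destruct (Nat.Even_or_Odd m) as [[i ->]|[i ->]];
  destruct (Nat.Even_or_Odd n) as [[j ->]|[j ->]];
  rewrite ?int_enum_even, ?int_enum_odd; lia.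
Qed.

Lemma is_series_int_enum (a : Z -> R) : ex_series_Z a ->
  is_series (fun n => a (int_enum n)) (Series_Z a).
Proof.
  intros [H1 H2]. apply is_series_even_odd.
  - eapply is_series_ext; [|apply (Series_correct _ H1)].
    intro n; cbv beta. now rewrite int_enum_even.
  - eapply is_series_ext; [|apply (Series_correct _ H2)].
    intro n; cbv beta. now rewrite int_enum_odd.
Qed.

(** * The power series of the heat trace *)

Lemma exp_ge_1_plus (x : R) : 1 + x <= exp x.
Proof.
  destruct (Req_dec x 0) as [->|H].
  - rewrite exp_0; lra.
  - left; now apply exp_ineq1.
Qed.

Lemma exp_nondecreasing (x y : R) : x <= y -> exp x <= exp y.
Proof.
  intros [H| ->]; [left; now apply exp_increasing|lra].
Qed.

Lemma Rabs_exp_sub_1 (y : R) : Rabs (exp y - 1) <= Rabs y * exp (Rabs y).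
Proof.
  assert (Hpos := exp_pos (Rabs y)). assert (Hy := Rabs_pos y).
  assert (H1 := exp_ge_1_plus (Rabs y)).
  destruct (Rle_or_lt 0 y) as [H|H].
  - rewrite (Rabs_pos_eq y) in * by auto.
    rewrite Rabs_pos_eq by lra.
    assert (H2 := exp_ge_1_plus (- y)).
    assert (H3 : exp y * (1 - y) <= 1).
    { apply Rle_trans with (exp y * / exp y); [|rewrite Rinv_r; lra].
      apply Rmult_le_compat_l; [lra|]. rewrite <- exp_Ropp; lra. }
    lra.
  - rewrite (Rabs_left y) in * by auto.
    assert (H2 := exp_ge_1_plus y).
    rewrite Rabs_left1.
    + nra.
    + assert (exp y <= exp 0); [left; now apply exp_increasing|].
      rewrite exp_0 in *. lra.
Qed.

Lemma sinh_pos (m : R) : 0 < m -> 0 < sinh m.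
Proof. intro H. rewrite <- sinh_0. now apply sinh_lt. Qed.

Lemma sinh_neq_0 (x : R) : x <> 0 -> sinh x <> 0.
Proof.
  intros Hx H. rewrite <- sinh_0 in H.
  destruct (Rtotal_order x 0) as [H0|[H0|H0]]; auto; apply sinh_lt in H0; lra.
Qed.

Lemma cosh_pos (m : R) : 0 < cosh m.
Proof. unfold cosh. generalize (exp_pos m) (exp_pos (- m)). lra. Qed.

Lemma coth_sub_1 (m : R) : 0 < m -> coth m - 1 = 2 * exp (- (2 * m)) / (1 - exp (- (2 * m))).
Proof.
  intro Hm. assert (Hs := sinh_pos m Hm).
  unfold coth. unfold cosh, sinh in *.
  replace (- (2 * m)) with (- m + - m) by ring. rewrite exp_plus, !exp_Ropp in *.
  assert (HE := exp_pos m). set (E := exp m) in *.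
  assert (0 < E * E - 1).
  { replace (E * E - 1) with (2 * ((E - / E) / 2) * E) by (field; lra). nra. }
  field. repeat split; nra.
Qed.

Lemma one_sub_tanh (m : R) : 1 - tanh m = 2 * exp (- (2 * m)) / (1 + exp (- (2 * m))).
Proof.
  unfold tanh, cosh, sinh.
  replace (- (2 * m)) with (- m + - m) by ring. rewrite exp_plus, !exp_Ropp.
  assert (HE := exp_pos m). set (E := exp m) in *.
  field. repeat split; nra.
Qed.

(** With E = e^{-2m} the defect is 2 m E / (1 - E). Both upper bounds reduce to (1 + 2m) E <= 1,
    that is 1 + 2m <= e^{2m}. *)
Lemma coth_defect (m : R) : 0 < m ->
  0 <= m * coth m - m <= (1 + 2 * m) * exp (- (2 * m)) /\ m * coth m - m <= 1.
Proof.
  intro Hm.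
  replace (m * coth m - m) with (m * (coth m - 1)) by ring. rewrite coth_sub_1 by auto.
  assert (HE := exp_pos (- (2 * m))).
  assert (Hm1 := exp_ge_1_plus (2 * m)).
  assert (HEi : exp (- (2 * m)) * exp (2 * m) = 1).
  { rewrite <- exp_plus, <- exp_0. f_equal; ring. }
  set (E := exp (- (2 * m))) in *. set (F := exp (2 * m)) in *.
  assert (H1 : (1 + 2 * m) * E <= 1) by nra.
  assert (HE1 : 0 < 1 - E) by nra.
  assert (HX : m * (2 * E / (1 - E)) = (2 * m * E) * / (1 - E)) by (field; lra).
  rewrite HX.
  assert (Hinv : 0 < / (1 - E)) by now apply Rinv_0_lt_compat.
  repeat split.
  - apply Rmult_le_pos; nra.
  - apply Rmult_le_reg_r with (1 - E); auto.
    rewrite Rmult_assoc, Rinv_l, Rmult_1_r by lra. nra.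
  - apply Rmult_le_reg_r with (1 - E); auto.
    rewrite Rmult_assoc, Rinv_l, Rmult_1_r by lra. nra.
Qed.

Lemma tanh_defect (m : R) : 0 < m ->
  0 <= m - m * tanh m <= (1 + 2 * m) * exp (- (2 * m)) /\ m - m * tanh m <= 1.
Proof.
  intro Hm.
  replace (m - m * tanh m) with (m * (1 - tanh m)) by ring. rewrite one_sub_tanh.
  assert (HE := exp_pos (- (2 * m))).
  assert (Hm1 := exp_ge_1_plus (2 * m)).
  assert (HEi : exp (- (2 * m)) * exp (2 * m) = 1).
  { rewrite <- exp_plus, <- exp_0. f_equal; ring. }
  set (E := exp (- (2 * m))) in *. set (F := exp (2 * m)) in *.
  assert (H1 : (1 + 2 * m) * E <= 1) by nra.
  assert (HX : m * (2 * E / (1 + E)) = (2 * m * E) * / (1 + E)) by (field; lra).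
  rewrite HX.
  assert (Hinv : 0 < / (1 + E)) by (apply Rinv_0_lt_compat; lra).
  repeat split.
  - apply Rmult_le_pos; nra.
  - apply Rmult_le_reg_r with (1 + E); [lra|].
    rewrite Rmult_assoc, Rinv_l, Rmult_1_r by lra. nra.
  - apply Rmult_le_reg_r with (1 + E); [lra|].
    rewrite Rmult_assoc, Rinv_l, Rmult_1_r by lra. nra.
Qed.

Lemma exp_pow (x : R) (n : nat) : exp x ^ n = exp (INR n * x).
Proof.
  induction n as [|n IH].
  - simpl. now rewrite Rmult_0_l, exp_0.
  - rewrite <- tech_pow_Rmult, IH, S_INR, <- exp_plus. f_equal; ring.
Qed.

Lemma ex_series_exp_decay (eps : R) (m : nat -> R) : 0 < eps ->
  (forall n, INR n - 1 <= m n) -> ex_series (fun n => exp (- eps * m n)).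
Proof.
  intros He Hm.
  apply (ex_series_le (V := R_CompleteNormedModule) _ (fun n => exp eps * exp (- eps) ^ n)).
  - intro n. change (norm ?x) with (Rabs x). rewrite Rabs_pos_eq by (left; apply exp_pos).
    rewrite exp_pow, <- exp_plus.
    apply exp_nondecreasing. specialize (Hm n). nra.
  - apply (ex_series_scal (V := R_NormedModule) (exp eps) (fun n => exp (- eps) ^ n)).
    apply ex_series_geom. rewrite Rabs_pos_eq by (left; apply exp_pos).
    rewrite <- exp_0. apply exp_increasing; lra.
Qed.

Lemma ex_series_exp_defect (t : R) (lam m : nat -> R) : 0 < t < 2 ->
  (forall n, 0 < m n) -> (forall n, INR n - 1 <= m n) ->
  (forall n, Rabs (lam n - m n) <= (1 + 2 * m n) * exp (- (2 * m n))) ->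
  (forall n, Rabs (lam n - m n) <= 1) ->
  ex_series (fun n => Rabs (exp (t * lam n) - exp (t * m n))).
Proof.
  intros Ht Hm0 Hm1 Hd Hd1.
  set (eps := 2 - t).
  (* The factor t e^t comes from |e^{tD} - 1| <= t |D| e^{t|D|} with |D| <= 1. The factor 1 + 4 /
     eps is the price for absorbing 1 + 2m into e^{eps m / 2}, which uses half of the decay e^{-eps
     m} left by e^{tm} e^{-2m}. *)
  set (K := t * exp t * (1 + 4 / eps)).
  assert (Heps : 0 < eps) by (unfold eps; lra).
  apply (ex_series_le (V := R_CompleteNormedModule) _
           (fun n => K * exp (- (eps / 2) * m n))).
  - intro n. change (norm ?x) with (Rabs x). rewrite Rabs_Rabsolu.
    specialize (Hm0 n). specialize (Hm1 n). specialize (Hd n). specialize (Hd1 n).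
    set (M := m n) in *. set (L := lam n) in *.
    replace (exp (t * L) - exp (t * M)) with (exp (t * M) * (exp (t * (L - M)) - 1)).
    2:{ rewrite Rmult_minus_distr_l, <- exp_plus. f_equal; [f_equal|]; ring. }
    rewrite Rabs_mult, (Rabs_pos_eq (exp (t * M))) by (left; apply exp_pos).
    assert (H1 := Rabs_exp_sub_1 (t * (L - M))).
    rewrite Rabs_mult, (Rabs_pos_eq t) in H1 by lra.
    set (D := Rabs (L - M)) in *. assert (HD : 0 <= D) by apply Rabs_pos.
    assert (H2 : exp (t * D) <= exp t) by (apply exp_nondecreasing; nra).
    assert (H3 : 1 + 2 * M <= (1 + 4 / eps) * exp (eps / 2 * M)).
    { assert (H4 := exp_ge_1_plus (eps / 2 * M)).
      assert (0 < 4 / eps) by (apply Rdiv_lt_0_compat; lra).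
      assert (4 / eps * (eps / 2 * M) = 2 * M) by (field; lra).
      assert (0 < eps / 2 * M) by nra. nra. }
    assert (H5 : exp (t * M) * ((1 + 2 * M) * exp (- (2 * M)))
                 <= (1 + 4 / eps) * exp (- (eps / 2) * M)).
    { replace (exp (t * M) * ((1 + 2 * M) * exp (- (2 * M))))
        with ((1 + 2 * M) * exp (- eps * M)).
      2:{ replace (- eps * M) with (t * M + - (2 * M)) by (unfold eps; ring).
          rewrite exp_plus; ring. }
      replace (- (eps / 2) * M) with (eps / 2 * M + - eps * M) by field.
      rewrite exp_plus, <- Rmult_assoc.
      apply Rmult_le_compat_r; auto. left; apply exp_pos. }
    assert (HtM := exp_pos (t * M)). assert (Het := exp_pos t).
    apply Rle_trans with (exp (t * M) * (t * D * exp t)).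
    { apply Rmult_le_compat_l; [lra|].
      apply Rle_trans with (1 := H1). apply Rmult_le_compat_l; auto.
      apply Rmult_le_pos; lra. }
    apply Rle_trans with (t * exp t * (exp (t * M) * ((1 + 2 * M) * exp (- (2 * M))))).
    { replace (exp (t * M) * (t * D * exp t)) with (t * exp t * (exp (t * M) * D)) by ring.
      apply Rmult_le_compat_l; [nra|]. apply Rmult_le_compat_l; lra. }
    unfold K. rewrite (Rmult_assoc (t * exp t)).
    apply Rmult_le_compat_l; [nra|auto].
  - apply (ex_series_scal (V := R_NormedModule) K (fun n => exp (- (eps / 2) * m n))).
    apply ex_series_exp_decay; auto. lra.
Qed.

Lemma coth_opp (x : R) : coth (- x) = - coth x.
Proof.
  unfold coth, cosh, sinh, Rdiv. rewrite Ropp_involutive.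
  replace (exp (- x) - exp x) with (- (exp x - exp (- x))) by ring.
  rewrite Ropp_mult_distr_l_reverse, Rinv_opp, (Rplus_comm (exp (- x))). ring.
Qed.

Lemma tanh_opp (x : R) : tanh (- x) = - tanh x.
Proof.
  unfold tanh, cosh, sinh, Rdiv. rewrite Ropp_involutive, (Rplus_comm (exp (- x))).
  replace (exp (- x) - exp x) with (- (exp x - exp (- x))) by ring. ring.
Qed.

Lemma lambda_plus_Rabs (nu : R) (k : Z) :
  lambda_plus nu k = Rabs (IZR k - nu) * coth (Rabs (IZR k - nu)).
Proof.
  unfold lambda_plus. unfold Rabs at 1 2. destruct (Rcase_abs (IZR k - nu)); auto.
  rewrite coth_opp; ring.
Qed.

Lemma lambda_minus_Rabs (nu : R) (k : Z) :
  lambda_minus nu k = Rabs (IZR k - nu) * tanh (Rabs (IZR k - nu)).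
Proof.
  unfold lambda_minus. unfold Rabs at 1 2. destruct (Rcase_abs (IZR k - nu)); auto.
  rewrite tanh_opp; ring.
Qed.

Lemma IZR_sub_nz (nu : R) (k : Z) : 0 < nu < 1 -> IZR k - nu <> 0.
Proof.
  intros H E. assert (E' : nu = IZR k) by lra. rewrite E' in H.
  destruct H as [H1 H2]. apply lt_IZR in H1. apply lt_IZR in H2. lia.
Qed.

Lemma lambda_plus_nonneg (nu : R) (k : Z) : 0 < nu < 1 -> 0 <= lambda_plus nu k.
Proof.
  intro H. rewrite lambda_plus_Rabs.
  assert (Hm := Rabs_pos_lt _ (IZR_sub_nz nu k H)).
  destruct (coth_defect _ Hm). lra.
Qed.

Lemma lambda_minus_nonneg (nu : R) (k : Z) : 0 <= lambda_minus nu k.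
Proof.
  rewrite lambda_minus_Rabs. apply Rmult_le_pos; [apply Rabs_pos|].
  assert (Hm := Rabs_pos (IZR k - nu)). set (m := Rabs _) in *.
  unfold tanh. apply Rmult_le_pos; [|left; apply Rinv_0_lt_compat, cosh_pos].
  destruct Hm as [Hm|<-]; [left; now apply sinh_pos|rewrite sinh_0; lra].
Qed.

Lemma lambda_plus_defect (nu : R) (k : Z) : 0 < nu < 1 ->
  let m := Rabs (IZR k - nu) in
  Rabs (lambda_plus nu k - m) <= (1 + 2 * m) * exp (- (2 * m)) /\
  Rabs (lambda_plus nu k - m) <= 1.
Proof.
  intros H m. rewrite lambda_plus_Rabs. fold m.
  assert (Hm := Rabs_pos_lt _ (IZR_sub_nz nu k H)). fold m in Hm.
  destruct (coth_defect m Hm). rewrite Rabs_pos_eq; lra.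
Qed.

Lemma lambda_minus_defect (nu : R) (k : Z) : 0 < nu < 1 ->
  let m := Rabs (IZR k - nu) in
  Rabs (lambda_minus nu k - m) <= (1 + 2 * m) * exp (- (2 * m)) /\
  Rabs (lambda_minus nu k - m) <= 1.
Proof.
  intros H m. rewrite lambda_minus_Rabs. fold m.
  assert (Hm := Rabs_pos_lt _ (IZR_sub_nz nu k H)). fold m in Hm.
  destruct (tanh_defect m Hm). rewrite Rabs_left1; lra.
Qed.

(** The two halves of [Series_Z] under one Boolean, so that each estimate is proved once for
    both. *)
Definition half_line (up : bool) (n : nat) : Z :=
  if up then Z.of_nat n else (- Z.of_nat (S n))%Z.

Lemma IZR_half_line (up : bool) (n : nat) :
  IZR (half_line up n) = if up then INR n else - (INR n + 1).
Proof.
  destruct up; unfold half_line.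
  - symmetry; apply INR_IZR_INZ.
  - now rewrite opp_IZR, <- INR_IZR_INZ, S_INR.
Qed.

Lemma half_line_ge (nu : R) (up : bool) (n : nat) : 0 < nu < 1 ->
  INR n - 1 <= Rabs (IZR (half_line up n) - nu).
Proof.
  intro H. rewrite IZR_half_line. assert (Hn := pos_INR n). destruct up.
  - eapply Rle_trans; [|apply Rle_abs]. lra.
  - rewrite <- Rabs_Ropp. eapply Rle_trans; [|apply Rle_abs]. lra.
Qed.

(** All that the power series argument uses of an eigenvalue family; it lets [lambda_plus] and
    [lambda_minus] share that argument. *)
Definition close_to_abs (lambda : R -> Z -> R) (nu : R) : Prop :=
  (forall k, 0 <= lambda nu k) /\
  forall k, let m := Rabs (IZR k - nu) in
  Rabs (lambda nu k - m) <= (1 + 2 * m) * exp (- (2 * m)) /\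
  Rabs (lambda nu k - m) <= 1.

Lemma close_to_abs_plus (nu : R) : 0 < nu < 1 -> close_to_abs lambda_plus nu.
Proof.
  intro H; split; intro k.
  - now apply lambda_plus_nonneg.
  - now apply lambda_plus_defect.
Qed.

Lemma close_to_abs_minus (nu : R) : 0 < nu < 1 -> close_to_abs lambda_minus nu.
Proof.
  intro H; split; intro k.
  - apply lambda_minus_nonneg.
  - now apply lambda_minus_defect.
Qed.

Definition heat_diff (lambda : R -> Z -> R) (nu t : R) (k : Z) : R :=
  exp (- t * lambda nu k) - exp (- t * Rabs (IZR k - nu)).

Lemma half_line_power_series (lambda : R -> Z -> R) (nu t : R) (up : bool) :
  0 < nu < 1 -> close_to_abs lambda nu -> 0 < t < 2 ->
  (forall p, ex_series (fun n => a_term lambda nu p (half_line up n))) /\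
  ex_series (fun n => heat_diff lambda nu t (half_line up n)) /\
  ex_series (fun p => Rabs ((-1) ^ p / INR (fact p)
      * Series (fun n => a_term lambda nu p (half_line up n)) * t ^ p)) /\
  is_series (fun p => (-1) ^ p / INR (fact p)
      * Series (fun n => a_term lambda nu p (half_line up n)) * t ^ p)
    (Series (fun n => heat_diff lambda nu t (half_line up n))).
Proof.
  intros Hnu [Hf1 Hf2] Ht.
  apply (exp_diff_power_series t (fun n => lambda nu (half_line up n))
    (fun n => Rabs (IZR (half_line up n) - nu))).
  - lra.
  - intro n; apply Hf1.
  - intro n; apply Rabs_pos.
  - apply ex_series_exp_defect; auto.
    + intro n. apply Rabs_pos_lt, IZR_sub_nz, Hnu.
    + intro n. now apply half_line_ge.
    + intro n. apply Hf2.
    + intro n. apply Hf2.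
Qed.

Lemma Z_power_series (lambda : R -> Z -> R) (nu t : R) :
  0 < nu < 1 -> close_to_abs lambda nu -> 0 < t < 2 ->
  (forall p, ex_series_Z (a_term lambda nu p)) /\
  ex_series_Z (heat_diff lambda nu t) /\
  ex_series (fun p => Rabs (a_coef lambda nu p * t ^ p)) /\
  is_series (fun p => a_coef lambda nu p * t ^ p) (Series_Z (heat_diff lambda nu t)).
Proof.
  intros Hnu Hf Ht.
  destruct (half_line_power_series lambda nu t true Hnu Hf Ht) as [A1 [A2 [A3 A4]]].
  destruct (half_line_power_series lambda nu t false Hnu Hf Ht) as [B1 [B2 [B3 B4]]].
  assert (Hc : forall p, a_coef lambda nu p * t ^ p =
    (-1) ^ p / INR (fact p) * Series (fun n => a_term lambda nu p (half_line true n)) * t ^ p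
    + (-1) ^ p / INR (fact p) * Series (fun n => a_term lambda nu p (half_line false n)) * t ^ p).
  { intro p. unfold a_coef, Series_Z, half_line. ring. }
  repeat split.
  - apply A1.
  - apply B1.
  - exact A2.
  - exact B2.
  - apply (ex_series_le (V := R_CompleteNormedModule) _ _) with (2 := ex_series_plus _ _ A3 B3).
    intro p. change (norm ?x) with (Rabs x). rewrite Rabs_Rabsolu, Hc. apply Rabs_triang.
  - eapply is_series_ext; [|apply (is_series_plus _ _ _ _ A4 B4)].
    intro p. cbv beta. now rewrite Hc.
Qed.

(** * Geometric sums for the eigenvalues |k - nu| *)

Lemma is_series_exp_half_lines (nu t : R) : 0 < nu < 1 -> 0 < t ->
  is_series (fun n => exp (- t * Rabs (IZR (half_line true n) - nu)))
    (exp (- t * nu) + exp (t * nu) * exp (- t) / (1 - exp (- t))) /\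
  is_series (fun n => exp (- t * Rabs (IZR (half_line false n) - nu)))
    (exp (- t * nu) * exp (- t) / (1 - exp (- t))).
Proof.
  intros Hnu Ht.
  assert (G : is_series (fun n => exp (- t) ^ n) (/ (1 - exp (- t)))).
  { apply is_series_geom. rewrite Rabs_pos_eq by (left; apply exp_pos).
    rewrite <- exp_0. apply exp_increasing; lra. }
  assert (G' : forall c, is_series (fun n => c * exp (- t) ^ n) (c / (1 - exp (- t)))).
  { intro c. exact (is_series_scal c _ _ G). }
  split.
  (* On the half-line k >= 0 only k = 0 has k - nu < 0; it is split off and the remaining terms are
     geometric. *)
  - apply is_series_decr_1.
    match goal with |- is_series _ ?l =>
      replace l with (exp (t * nu) * exp (- t) / (1 - exp (- t))) end.
    2:{ rewrite IZR_half_line. unfold plus, opp; simpl.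
        rewrite Rabs_left by lra. replace (- t * - (0 - nu)) with (- t * nu) by ring. ring. }
    eapply is_series_ext; [|apply G'].
    intro n. cbv beta. rewrite IZR_half_line, S_INR.
    assert (Hn := pos_INR n).
    rewrite Rabs_pos_eq by lra. rewrite exp_pow, <- !exp_plus. f_equal; ring.
  - eapply is_series_ext; [|apply G'].
    intro n. cbv beta. rewrite IZR_half_line.
    assert (Hn := pos_INR n).
    rewrite Rabs_left by lra. rewrite exp_pow, <- !exp_plus. f_equal; ring.
Qed.

Lemma Series_Z_exp (nu t : R) : 0 < nu < 1 -> 0 < t ->
  ex_series_Z (fun k => exp (- t * Rabs (IZR k - nu))) /\
  Series_Z (fun k => exp (- t * Rabs (IZR k - nu))) =
    cosh (t * (nu - 1 / 2)) / sinh (t / 2).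
Proof.
  intros Hnu Ht.
  destruct (is_series_exp_half_lines nu t Hnu Ht) as [H1 H2].
  split; [split; eexists; eassumption|].
  unfold Series_Z. unfold half_line in H1, H2.
  rewrite (is_series_unique _ _ H1), (is_series_unique _ _ H2).
  assert (Hs := sinh_pos (t / 2)).
  unfold cosh, sinh in *.
  replace (- t * nu) with (- (t * nu)) by ring.
  replace (- t) with (- (t / 2) + - (t / 2)) by field.
  replace (t * (nu - 1 / 2)) with (t * nu + - (t / 2)) by field.
  replace (- (t * nu + - (t / 2))) with (- (t * nu) + t / 2) by field.
  rewrite !exp_plus, !exp_Ropp in *.
  assert (HE := exp_pos (t / 2)). assert (HF := exp_pos (t * nu)).
  set (E := exp (t / 2)) in *. set (F := exp (t * nu)) in *.
  assert (0 < E * E - 1).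
  { replace (E * E - 1) with (2 * ((E - / E) / 2) * E) by (field; lra). nra. }
  field. repeat split; nra.
Qed.

Lemma Series_Z_heat (lambda : R -> Z -> R) (nu t : R) :
  0 < nu < 1 -> close_to_abs lambda nu -> 0 < t < 2 ->
  ex_series_Z (fun k => exp (- t * lambda nu k)) /\
  Series_Z (fun k => exp (- t * lambda nu k)) =
    cosh (t * (nu - 1 / 2)) / sinh (t / 2) + Series_Z (heat_diff lambda nu t).
Proof.
  intros Hnu Hf Ht.
  destruct (Z_power_series lambda nu t Hnu Hf Ht) as [_ [[A1 A2] _]].
  destruct (Series_Z_exp nu t Hnu (proj1 Ht)) as [[B1 B2] <-].
  assert (E : forall k, exp (- t * lambda nu k) =
     exp (- t * Rabs (IZR k - nu)) + heat_diff lambda nu t k)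
    by (intro; unfold heat_diff; ring).
  split.
  - split.
    + eapply ex_series_ext; [|exact (ex_series_plus _ _ B1 A1)].
      intro n; cbv beta; now rewrite E.
    + eapply ex_series_ext; [|exact (ex_series_plus _ _ B2 A2)].
      intro n; cbv beta; now rewrite E.
  - unfold Series_Z.
    rewrite (Series_ext (fun n => exp (- t * lambda nu (Z.of_nat n))) _ (fun n => E _)),
      (Series_ext (fun n => exp (- t * lambda nu (- Z.of_nat (S n))%Z)) _ (fun n => E _)).
    rewrite !Series_plus; auto. ring.
Qed.

(** * Small-time expansion of the hyperbolic quotient *)

Lemma exp_taylor_3 (x : R) : Rabs x <= 1 ->
  Rabs (exp x - (1 + x + x ^ 2 / 2 + x ^ 3 / 6)) <= 3 * x ^ 4.
Proof.
  intro Hx.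
  assert (H : is_series (fun k => x ^ (4 + k) / INR (fact (4 + k)))
                (exp x - (1 + x + x ^ 2 / 2 + x ^ 3 / 6))).
  { apply (is_series_incr_n (fun k => x ^ k / INR (fact k)) 4); [lia|].
    replace (plus _ _) with (exp x); [apply is_series_exp|].
    rewrite sum_n_Reals. unfold plus; simpl. field. }
  assert (H4 : is_series (fun k => x ^ 4 * (Rabs x ^ k / INR (fact k))) (x ^ 4 * exp (Rabs x))).
  { exact (is_series_scal (x ^ 4) _ _ (is_series_exp (Rabs x))). }
  assert (H4' := is_series_scal (-1) _ _ H4).
  (* The remainder series starts at order 4. Since (4 + k)! >= k!, it is dominated term by term by
     x^4 times the series of e^{|x|}, and e^{|x|} <= e <= 3. *)
  assert (Hb : forall k, Rabs (x ^ (4 + k) / INR (fact (4 + k)))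
                 <= x ^ 4 * (Rabs x ^ k / INR (fact k))).
  { intro k. unfold Rdiv. rewrite Rabs_mult, <- RPow_abs, pow_add, Rmult_assoc.
    replace (Rabs x ^ 4) with (x ^ 4).
    2:{ rewrite RPow_abs. symmetry; apply Rabs_pos_eq.
        replace (x ^ 4) with ((x ^ 2) ^ 2) by ring. apply pow2_ge_0. }
    apply Rmult_le_compat_l.
    - replace (x ^ 4) with ((x ^ 2) ^ 2) by ring. apply pow2_ge_0.
    - apply Rmult_le_compat_l; [apply pow_le, Rabs_pos|].
      rewrite Rabs_pos_eq by (left; apply Rinv_0_lt_compat, INR_fact_lt_0).
      apply Rinv_le_contravar; [apply INR_fact_lt_0|].
      apply le_INR, fact_le. lia. }
  assert (He : exp (Rabs x) <= 3).
  { apply Rle_trans with (2 := exp_le_3). now apply exp_nondecreasing. }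
  assert (Hx4 : 0 <= x ^ 4).
  { replace (x ^ 4) with ((x ^ 2) ^ 2) by ring. apply pow2_ge_0. }
  assert (Hfin : x ^ 4 * exp (Rabs x) <= 3 * x ^ 4) by nra.
  apply Rabs_le. split.
  - apply Rle_trans with (-1 * (x ^ 4 * exp (Rabs x))); [lra|].
    refine (is_series_le _ _ _ _ _ H4' H).
    intro k. unfold scal; simpl; unfold mult; simpl.
    generalize (Hb k); simpl. intro Hk. apply Rabs_le_between in Hk. lra.
  - apply Rle_trans with (2 := Hfin).
    apply (is_series_le _ _ _ _ (fun k => Rle_trans _ _ _ (Rle_abs _) (Hb k)) H H4).
Qed.

Lemma cosh_taylor (y : R) : Rabs y <= 1 -> Rabs (cosh y - (1 + y ^ 2 / 2)) <= 3 * y ^ 4.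
Proof.
  intro Hy. assert (H1 := exp_taylor_3 y Hy).
  assert (H2 : Rabs (- y) <= 1) by now rewrite Rabs_Ropp.
  apply exp_taylor_3 in H2. unfold cosh.
  apply Rabs_le_between in H1. apply Rabs_le_between in H2.
  replace ((- y) ^ 4) with (y ^ 4) in H2 by ring.
  replace ((- y) ^ 3) with (- y ^ 3) in H2 by ring.
  replace ((- y) ^ 2) with (y ^ 2) in H2 by ring.
  apply Rabs_le. lra.
Qed.

Lemma sinh_taylor (y : R) : Rabs y <= 1 -> Rabs (sinh y - (y + y ^ 3 / 6)) <= 3 * y ^ 4.
Proof.
  intro Hy. assert (H1 := exp_taylor_3 y Hy).
  assert (H2 : Rabs (- y) <= 1) by now rewrite Rabs_Ropp.
  apply exp_taylor_3 in H2. unfold sinh.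
  apply Rabs_le_between in H1. apply Rabs_le_between in H2.
  replace ((- y) ^ 4) with (y ^ 4) in H2 by ring.
  replace ((- y) ^ 3) with (- y ^ 3) in H2 by ring.
  replace ((- y) ^ 2) with (y ^ 2) in H2 by ring.
  apply Rabs_le. lra.
Qed.

Lemma sinh_ge (z : R) : 0 < z -> z <= sinh z.
Proof.
  intro Hz.
  destruct (MVT_gen (fun y => sinh y - y) 0 z (fun y => cosh y - 1)) as [c [Hc E]].
  - intros y _. auto_derive; auto. ring.
  - intros y _. apply derivable_continuous_pt.
    exists (cosh y - 1). apply is_derive_Reals. auto_derive; auto. ring.
  - rewrite sinh_0 in E.
    assert (1 <= cosh c).
    { unfold cosh. assert (H1 := exp_ge_1_plus c). assert (H2 := exp_ge_1_plus (- c)). lra. }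
    nra.
Qed.

(** The error is multiplied by sinh (t/2) to clear the denominator, estimated to order t^3, and
    divided back using sinh (t/2) >= t/2, which turns 2 t^3 into 4 t^2. *)
Lemma cosh_div_sinh_asymptotics (b t : R) : Rabs b <= 1 / 2 -> 0 < t < 1 ->
  Rabs (2 * (cosh (t * b) / sinh (t / 2)) - (4 / t + (2 * b ^ 2 - 1 / 6) * t))
    <= 4 * t ^ 2.
Proof.
  intros Hb Ht.
  assert (Hb2 : Rabs b ^ 2 = b ^ 2) by apply pow2_abs.
  assert (Hb0 := Rabs_pos b).
  assert (HB : 0 <= b ^ 2 <= 1 / 4) by nra.
  assert (Hc := cosh_taylor (t * b)).
  assert (Hs := sinh_taylor (t / 2)).
  assert (Hsg := sinh_ge (t / 2)).
  assert (Hsp : 0 < sinh (t / 2)) by lra.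
  rewrite Rabs_mult, (Rabs_pos_eq t) in Hc by lra.
  rewrite (Rabs_pos_eq (t / 2)) in Hs by lra.
  assert (Hc' := Hc ltac:(nra)). assert (Hs' := Hs ltac:(lra)). clear Hc Hs.
  set (al := 2 * b ^ 2 - 1 / 6).
  set (R1 := cosh (t * b) - (1 + (t * b) ^ 2 / 2)) in *.
  set (R2 := sinh (t / 2) - (t / 2 + (t / 2) ^ 3 / 6)) in *.
  set (X := 2 * (cosh (t * b) / sinh (t / 2)) - (4 / t + al * t)).
  (* The value al = 2 b^2 - 1/6 is the one for which the t^2 terms cancel here; what is left has
     order at least t^3. *)
  assert (EX : X * sinh (t / 2) = 2 * R1 - al * t ^ 4 / 48 - (4 + al * t ^ 2) * (R2 / t)).
  { unfold X, R1, R2, al. field. lra. }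
  assert (Hal : Rabs al <= 1) by (apply Rabs_le; unfold al; lra).
  assert (Ht4 : 0 <= t ^ 4) by (apply pow_le; lra).
  assert (Ht3 : 0 <= t ^ 3) by (apply pow_le; lra).
  assert (Ht43 : t ^ 4 <= t ^ 3).
  { replace (t ^ 4) with (t ^ 3 * t) by ring. nra. }
  assert (B1 : Rabs R1 <= 3 / 16 * t ^ 3).
  { apply Rle_trans with (1 := Hc').
    replace ((t * b) ^ 4) with (t ^ 4 * (b ^ 2 * b ^ 2)) by ring.
    assert (b ^ 2 * b ^ 2 <= 1 / 16) by nra. nra. }
  assert (B2 : Rabs (R2 / t) <= 3 / 16 * t ^ 3).
  { unfold Rdiv. rewrite Rabs_mult, (Rabs_pos_eq (/ t))
      by (left; apply Rinv_0_lt_compat; lra).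
    apply Rmult_le_reg_r with t; [lra|].
    rewrite Rmult_assoc, Rinv_l, Rmult_1_r by lra.
    apply Rle_trans with (1 := Hs'). right; field. }
  assert (B3 : Rabs (4 + al * t ^ 2) <= 5).
  { apply Rabs_le. apply Rabs_le_between in Hal. assert (0 <= t ^ 2 <= 1) by nra. nra. }
  assert (B4 : Rabs X * sinh (t / 2) <= 2 * t ^ 3).
  { rewrite <- (Rabs_pos_eq (sinh (t / 2))) by lra. rewrite <- Rabs_mult, EX.
    assert (B5 : Rabs ((4 + al * t ^ 2) * (R2 / t)) <= 5 * (3 / 16 * t ^ 3)).
    { rewrite Rabs_mult. apply Rmult_le_compat; auto using Rabs_pos. }
    assert (B6 : Rabs (al * t ^ 4 / 48) <= t ^ 3 / 48).
    { unfold Rdiv. rewrite !Rabs_mult, (Rabs_pos_eq (t ^ 4)), (Rabs_pos_eq (/ 48)) by lra.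
      assert (Ha := Rabs_pos al). nra. }
    apply Rabs_le_between in B1. apply Rabs_le_between in B5. apply Rabs_le_between in B6.
    apply Rabs_le. lra. }
  assert (HX := Rabs_pos X).
  apply Rmult_le_reg_r with (t / 2); [lra|].
  apply Rle_trans with (Rabs X * sinh (t / 2)); [apply Rmult_le_compat_l; lra|].
  apply Rle_trans with (1 := B4). right; field.
Qed.

(** * Parseval's identity *)

Fixpoint dirichlet (n : nat) (d : R) : R :=
  match n with
  | O => 1
  | S m => dirichlet m d + 2 * cos (INR n * d)
  end.

Fixpoint fejer (n : nat) (d : R) : R :=
  match n with
  | O => 0
  | S m => fejer m d + dirichlet m d
  end.

Lemma cos_mul_cos (a d : R) : 2 * cos a * cos d = cos (a + d) + cos (a - d).
Proof. rewrite cos_plus, cos_minus. ring. Qed.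

Lemma dirichlet_telescope (n : nat) (d : R) :
  (1 - cos d) * dirichlet n d = cos (INR n * d) - cos (INR (S n) * d).
Proof.
  induction n as [|n IH].
  - change (dirichlet 0 d) with 1. change (INR 0) with 0. change (INR 1) with 1.
    rewrite Rmult_0_l, cos_0, Rmult_1_l. ring.
  - change (dirichlet (S n) d) with (dirichlet n d + 2 * cos (INR (S n) * d)).
    rewrite Rmult_plus_distr_l, IH.
    assert (H := cos_mul_cos (INR (S n) * d) d).
    replace (INR (S n) * d + d) with (INR (S (S n)) * d) in H
      by (rewrite (S_INR (S n)); ring).
    replace (INR (S n) * d - d) with (INR n * d) in H by (rewrite S_INR; ring).
    lra.
Qed.

(** Stated without division, so that it also holds at the zeros of 1 - cos d. *)
Lemma fejer_telescope (n : nat) (d : R) : (1 - cos d) * fejer n d = 1 - cos (INR n * d).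
Proof.
  induction n as [|n IH].
  - simpl. rewrite Rmult_0_l, cos_0. ring.
  - change (fejer (S n) d) with (fejer n d + dirichlet n d).
    rewrite Rmult_plus_distr_l, IH, dirichlet_telescope. ring.
Qed.

(** The factor 1 - cos d contained in the bound on y cancels the singularity of the kernel,
    uniformly in n; where cos d = 1, y itself is 0. *)
Lemma mul_fejer_bound (n : nat) (d K y : R) : 0 <= K -> 0 <= y <= K * (1 - cos d) ->
  0 <= y * fejer n d <= 2 * K.
Proof.
  intros HK Hy. assert (Hf := fejer_telescope n d).
  assert (Hc := COS_bound d). assert (Hc' := COS_bound (INR n * d)).
  destruct (Req_dec (cos d) 1) as [E|E].
  - rewrite E in Hy. replace y with 0 by lra. lra.
  - assert (0 < 1 - cos d) by lra.
    assert (Hpos : 0 <= fejer n d).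
    { apply Rmult_le_reg_l with (1 - cos d); lra. }
    split; [apply Rmult_le_pos; lra|].
    apply Rle_trans with (K * (1 - cos d) * fejer n d).
    + apply Rmult_le_compat_r; lra.
    + rewrite Rmult_assoc, Hf. nra.
Qed.

(** Here 1 - cos d = 2 sin^2 (d/2), and sin y >= y - y^3/6 >= y/3 on [0, 2]; with y = d/2 this gives
    2 (d/6)^2 = d^2 / 18. *)
Lemma sq_le_one_sub_cos (d : R) : Rabs d <= PI -> d ^ 2 <= 18 * (1 - cos d).
Proof.
  intro Hd.
  assert (Hwlog : forall x, 0 <= x <= PI -> x ^ 2 <= 18 * (1 - cos x)).
  { intros x Hx. assert (HP := PI_4).
    replace x with (2 * (x / 2)) by field. rewrite cos_2a_sin.
    destruct (sin_bound (x / 2) 0) as [H _]; [lra..|].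
    unfold sin_approx in H. simpl in H. unfold sin_term in H. simpl in H.
    set (y := x / 2) in *. assert (Hy : 0 <= y <= 2) by (unfold y; lra).
    assert (H1 : y / 3 <= sin y).
    { apply Rle_trans with (2 := H).
      assert (y * (y * y) <= 4 * y) by nra. lra. }
    nra. }
  destruct (Rle_or_lt 0 d) as [H|H].
  - apply Hwlog. rewrite Rabs_pos_eq in Hd; lra.
  - rewrite <- (cos_neg d). replace (d ^ 2) with ((- d) ^ 2) by ring.
    apply Hwlog. rewrite Rabs_left in Hd; lra.
Qed.

Definition periodic_C1 (f : R -> R) : Prop :=
  (forall x, f (x + 2 * PI) = f x) /\ (forall x, ex_derive f x) /\
  (forall x, continuous (Derive f) x).

Lemma continuous_Rabs_comp (f : R -> R) (x : R) :
  continuous f x -> continuous (fun y => Rabs (f y)) x.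
Proof. intro H. apply (continuous_comp f Rabs); auto. apply continuous_Rabs. Qed.

Lemma lipschitz_on_segment (f : R -> R) (a b : R) : a <= b ->
  (forall x, ex_derive f x) -> (forall x, continuous (Derive f) x) ->
  exists L, 0 <= L /\ forall x y, a <= x <= b -> a <= y <= b ->
    Rabs (f x - f y) <= L * Rabs (x - y).
Proof.
  intros Hab Hd Hc.
  destruct (continuity_ab_maj (fun x => Rabs (Derive f x)) a b Hab) as [M [HM _]].
  { intros c _. apply continuity_pt_filterlim. now apply continuous_Rabs_comp. }
  exists (Rabs (Derive f M)). split; [apply Rabs_pos|].
  intros x y Hx Hy.
  destruct (MVT_gen f y x (Derive f)) as [c [Hc1 ->]].
  - intros z _. now apply Derive_correct.
  - intros z _. apply continuity_pt_filterlim.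
    apply (ex_derive_continuous f). apply Hd.
  - rewrite Rabs_mult. apply Rmult_le_compat_r; [apply Rabs_pos|].
    apply HM. revert Hc1. unfold Rmin, Rmax. destruct (Rle_dec y x); lra.
Qed.

Lemma periodic_sq_diff_bound (f : R -> R) : periodic_C1 f ->
  exists K, 0 <= K /\ forall x y, 0 <= x <= 2 * PI -> 0 <= y <= 2 * PI ->
    0 <= (f x - f y) ^ 2 <= K * (1 - cos (x - y)).
Proof.
  intros [Hp [Hd Hc]]. assert (HP := PI_RGT_0).
  (* The segment leaves room to shift x or y by a period: when |x - y| > PI, adding 2 PI to the
     smaller of the two brings them within PI of each other. *)
  destruct (lipschitz_on_segment f (- (2 * PI)) (4 * PI) ltac:(lra) Hd Hc) as [L [HL HLip]].
  exists (18 * L ^ 2). split; [nra|].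
  assert (Hnear : forall x y, - (2 * PI) <= x <= 4 * PI -> - (2 * PI) <= y <= 4 * PI ->
     Rabs (x - y) <= PI -> (f x - f y) ^ 2 <= 18 * L ^ 2 * (1 - cos (x - y))).
  { intros x y Hx Hy Hxy.
    assert (H1 := sq_le_one_sub_cos _ Hxy).
    assert (H2 := HLip x y Hx Hy).
    rewrite <- (pow2_abs (f x - f y)). rewrite <- (pow2_abs (x - y)) in H1.
    assert (H3 := Rabs_pos (x - y)). assert (H4 := Rabs_pos (f x - f y)).
    apply Rle_trans with ((L * Rabs (x - y)) ^ 2).
    - apply pow_incr; auto.
    - rewrite Rpow_mult_distr. assert (0 <= L ^ 2) by nra. nra. }
  intros x y Hx Hy. split; [apply pow2_ge_0|].
  destruct (Rle_or_lt (Rabs (x - y)) PI) as [H|H].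
  - apply Hnear; auto; lra.
  - destruct (Rle_or_lt 0 (x - y)) as [H1|H1].
    + rewrite Rabs_pos_eq in H by lra.
      rewrite <- (Hp y). replace (cos (x - y)) with (cos (x - (y + 2 * PI))).
      * apply Hnear; [lra..|]. apply Rabs_le. lra.
      * rewrite <- (cos_period (x - (y + 2 * PI)) 1). f_equal. simpl; ring.
    + rewrite Rabs_left in H by lra.
      rewrite <- (Hp x). replace (cos (x - y)) with (cos (x + 2 * PI - y)).
      * apply Hnear; [lra..|]. apply Rabs_le. lra.
      * rewrite <- (cos_period (x - y) 1). f_equal. simpl; ring.
Qed.

Lemma is_RInt_ext_R (f g : R -> R) (a b l : R) :
  (forall x, f x = g x) -> is_RInt f a b l -> is_RInt g a b l.
Proof. intro H. apply is_RInt_ext. intros; apply H. Qed.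

Lemma RInt_ext_R (f g : R -> R) (a b : R) : (forall x, f x = g x) -> RInt f a b = RInt g a b.
Proof. intro H. apply RInt_ext. intros; apply H. Qed.

Lemma is_RInt_lin (a b u v iu iv : R) (g h : R -> R) :
  is_RInt g a b iu -> is_RInt h a b iv ->
  is_RInt (fun s => u * g s + v * h s) a b (u * iu + v * iv).
Proof.
  intros Hg Hh.
  exact (is_RInt_plus _ _ _ _ _ _ (is_RInt_scal _ _ _ u _ Hg) (is_RInt_scal _ _ _ v _ Hh)).
Qed.

Definition cos_coef (f : R -> R) (k : R) : R := RInt (fun x => f x * cos (k * x)) 0 (2 * PI).
Definition sin_coef (f : R -> R) (k : R) : R := RInt (fun x => f x * sin (k * x)) 0 (2 * PI).

Lemma is_RInt_cos_coef (f : R -> R) (k : R) : (forall x, continuous f x) ->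
  is_RInt (fun x => f x * cos (k * x)) 0 (2 * PI) (cos_coef f k).
Proof.
  intro H. apply (RInt_correct (V := R_CompleteNormedModule)).
  apply ex_RInt_continuous. intros x _. apply (continuous_mult f); auto.
  apply (ex_derive_continuous (fun x => cos (k * x))). auto_derive; auto.
Qed.

Lemma is_RInt_sin_coef (f : R -> R) (k : R) : (forall x, continuous f x) ->
  is_RInt (fun x => f x * sin (k * x)) 0 (2 * PI) (sin_coef f k).
Proof.
  intro H. apply (RInt_correct (V := R_CompleteNormedModule)).
  apply ex_RInt_continuous. intros x _. apply (continuous_mult f); auto.
  apply (ex_derive_continuous (fun x => sin (k * x))). auto_derive; auto.
Qed.

(** The iterated integral of (f x - f y)^2 F (x - y). As a relation with the inner integral h as
    witness, it carries integrability along with the value, so linearity in F has no side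
    conditions. *)
Definition is_diff_RInt2 (f F : R -> R) (v : R) : Prop :=
  exists h : R -> R,
    (forall x, is_RInt (fun y => (f x - f y) ^ 2 * F (x - y)) 0 (2 * PI) (h x)) /\
    is_RInt h 0 (2 * PI) v.

Lemma is_diff_RInt2_ext (f F G : R -> R) (v : R) : (forall d, F d = G d) ->
  is_diff_RInt2 f F v -> is_diff_RInt2 f G v.
Proof.
  intros H [h [H1 H2]]. exists h; split; auto.
  intro x. eapply is_RInt_ext_R; [|apply H1]. intros; cbv beta; now rewrite H.
Qed.

Lemma is_diff_RInt2_lin (f F G : R -> R) (a b v w : R) :
  is_diff_RInt2 f F v -> is_diff_RInt2 f G w ->
  is_diff_RInt2 f (fun d => a * F d + b * G d) (a * v + b * w).
Proof.
  intros [h [H1 H2]] [h' [H1' H2']].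
  exists (fun x => a * h x + b * h' x). split.
  - intro x. eapply is_RInt_ext_R; [|apply (is_RInt_lin _ _ a b _ _ _ _ (H1 x) (H1' x))].
    intros y; cbv beta; ring.
  - now apply is_RInt_lin.
Qed.

Lemma is_diff_RInt2_bound (f F : R -> R) (M v : R) :
  (forall x y, 0 <= x <= 2 * PI -> 0 <= y <= 2 * PI ->
     0 <= (f x - f y) ^ 2 * F (x - y) <= M) ->
  is_diff_RInt2 f F v -> 0 <= v <= 2 * PI * (2 * PI * M).
Proof.
  intros HM [h [H1 H2]]. assert (HP := PI_RGT_0).
  assert (Hcst : forall c, is_RInt (fun _ : R => c) 0 (2 * PI) (2 * PI * c)).
  { intro c. assert (H := is_RInt_const 0 (2 * PI) c).
    unfold scal in H; simpl in H. unfold mult in H; simpl in H.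
    now replace (2 * PI - 0) with (2 * PI) in H by ring. }
  assert (Hh : forall x, 0 <= x <= 2 * PI -> 0 <= h x <= 2 * PI * M).
  { intros x Hx. split.
    - rewrite <- (Rmult_0_r (2 * PI)).
      apply (is_RInt_le (fun _ => 0) (fun y => (f x - f y) ^ 2 * F (x - y)) 0 (2 * PI));
        auto; [lra|]. intros; apply HM; lra.
    - apply (is_RInt_le (fun y => (f x - f y) ^ 2 * F (x - y)) (fun _ => M) 0 (2 * PI));
        auto; [lra|]. intros; apply HM; lra. }
  split.
  - rewrite <- (Rmult_0_r (2 * PI)).
    apply (is_RInt_le (fun _ => 0) h 0 (2 * PI)); auto; [lra|]. intros; apply Hh; lra.
  - apply (is_RInt_le h (fun _ => 2 * PI * M) 0 (2 * PI)); auto; [lra|].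
    intros; apply Hh; lra.
Qed.

(** The square and cos (kx - ky) are expanded. The cross term -2 f x f y produces the energy of f at
    frequency k, and the two squares pair the coefficients of f^2 with those of the constant 1. *)
Lemma is_diff_RInt2_cos (f : R -> R) (k : R) : (forall x, continuous f x) ->
  is_diff_RInt2 f (fun d => cos (k * d))
    (2 * (cos_coef (fun _ => 1) k * cos_coef (fun x => f x ^ 2) k
          + sin_coef (fun _ => 1) k * sin_coef (fun x => f x ^ 2) k)
     - 2 * (cos_coef f k ^ 2 + sin_coef f k ^ 2)).
Proof.
  intro Hf.
  assert (H1 : forall x, continuous (fun _ : R => 1) x) by (intro; apply continuous_const).
  assert (Hf2 : forall x, continuous (fun x => f x ^ 2) x).
  { intro x. apply continuous_ext with (fun x => f x * f x).
    - intro y; apply Rsqr_pow2.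
    - now apply (continuous_mult f f). }
  assert (A0 := is_RInt_cos_coef _ k H1). assert (B0 := is_RInt_sin_coef _ k H1).
  assert (A1 := is_RInt_cos_coef _ k Hf). assert (B1 := is_RInt_sin_coef _ k Hf).
  assert (A2 := is_RInt_cos_coef _ k Hf2). assert (B2 := is_RInt_sin_coef _ k Hf2).
  set (a0 := cos_coef (fun _ => 1) k) in *. set (b0 := sin_coef (fun _ => 1) k) in *.
  set (a1 := cos_coef f k) in *. set (b1 := sin_coef f k) in *.
  set (a2 := cos_coef (fun x => f x ^ 2) k) in *.
  set (b2 := sin_coef (fun x => f x ^ 2) k) in *.
  (* For fixed x the inner integrand has this shape, with c = cos (k x), s = sin (k x), p = (f x)^2,
     q = -2 f x and r = 1. *)
  assert (key : forall c s p q r,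
    is_RInt (fun y => p * (c * (1 * cos (k * y)) + s * (1 * sin (k * y)))
        + 1 * (q * (c * (f y * cos (k * y)) + s * (f y * sin (k * y)))
               + r * (c * (f y ^ 2 * cos (k * y)) + s * (f y ^ 2 * sin (k * y)))))
      0 (2 * PI) (p * (c * a0 + s * b0) + 1 * (q * (c * a1 + s * b1) + r * (c * a2 + s * b2)))).
  { intros c s p q r. repeat (first [assumption | apply (is_RInt_lin 0 (2 * PI))]). }
  exists (fun x => f x ^ 2 * (cos (k * x) * a0 + sin (k * x) * b0)
            + 1 * (- 2 * f x * (cos (k * x) * a1 + sin (k * x) * b1)
                   + 1 * (cos (k * x) * a2 + sin (k * x) * b2))).
  split.
  - intro x. eapply is_RInt_ext_R; [|apply (key (cos (k * x)) (sin (k * x)))].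
    intros y. cbv beta.
    replace (k * (x - y)) with (k * x - k * y) by ring. rewrite cos_minus. ring.
  - assert (key2 : is_RInt (fun x =>
       1 * (a0 * (f x ^ 2 * cos (k * x)) + b0 * (f x ^ 2 * sin (k * x)))
       + 1 * (1 * (-2 * a1 * (f x * cos (k * x)) + -2 * b1 * (f x * sin (k * x)))
              + 1 * (a2 * (1 * cos (k * x)) + b2 * (1 * sin (k * x)))))
       0 (2 * PI) (1 * (a0 * a2 + b0 * b2) + 1 * (1 * (-2 * a1 * a1 + -2 * b1 * b1)
              + 1 * (a2 * a0 + b2 * b0)))).
    { repeat (first [assumption | apply (is_RInt_lin 0 (2 * PI))]). }
    replace (2 * (a0 * a2 + b0 * b2) - 2 * (a1 ^ 2 + b1 ^ 2))
      with (1 * (a0 * a2 + b0 * b2) + 1 * (1 * (-2 * a1 * a1 + -2 * b1 * b1)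
              + 1 * (a2 * a0 + b2 * b0))) by ring.
    eapply is_RInt_ext_R; [|exact key2]. intros x; cbv beta. ring.
Qed.

Lemma cos_2PI_Z (k : Z) : cos (IZR k * (2 * PI)) = 1.
Proof.
  assert (H : forall n, cos (INR n * (2 * PI)) = 1).
  { intro n. rewrite <- cos_0, <- (cos_period 0 n). f_equal; ring. }
  destruct (Z_le_dec 0 k) as [Hk|Hk].
  - rewrite <- (Z2Nat.id k Hk), <- INR_IZR_INZ. apply H.
  - rewrite <- cos_neg. replace (- (IZR k * (2 * PI))) with (IZR (- k) * (2 * PI))
      by (rewrite opp_IZR; ring).
    rewrite <- (Z2Nat.id (- k)) by lia. rewrite <- INR_IZR_INZ. apply H.
Qed.

Lemma sin_2PI_Z (k : Z) : sin (IZR k * (2 * PI)) = 0.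
Proof.
  assert (H := sin2_cos2 (IZR k * (2 * PI))). rewrite cos_2PI_Z in H.
  unfold Rsqr in H. nra.
Qed.

Lemma is_RInt_cos_Z (k : Z) :
  is_RInt (fun x => cos (IZR k * x)) 0 (2 * PI) (if Z.eq_dec k 0 then 2 * PI else 0).
Proof.
  destruct (Z.eq_dec k 0) as [->|Hk].
  - apply is_RInt_ext_R with (fun _ => 1).
    + intros; now rewrite Rmult_0_l, cos_0.
    + assert (H := is_RInt_const 0 (2 * PI) 1).
      unfold scal in H; simpl in H. unfold mult in H; simpl in H.
      now replace ((2 * PI - 0) * 1) with (2 * PI) in H by ring.
  - assert (Hk' : IZR k <> 0) by now apply eq_IZR_contrapositive.
    replace 0 with (minus (sin (IZR k * (2 * PI)) / IZR k) (sin (IZR k * 0) / IZR k)) at 2.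
    + apply (is_RInt_derive (fun x => sin (IZR k * x) / IZR k)).
      * intros x _. auto_derive; auto. field; auto.
      * intros x _. apply (ex_derive_continuous (fun x => cos (IZR k * x))).
        auto_derive; auto.
    + rewrite sin_2PI_Z, Rmult_0_r, sin_0. unfold minus, plus, opp; simpl. field; auto.
Qed.

Lemma is_RInt_sin_Z (k : Z) : is_RInt (fun x => sin (IZR k * x)) 0 (2 * PI) 0.
Proof.
  destruct (Z.eq_dec k 0) as [->|Hk].
  - apply is_RInt_ext_R with (fun _ => 0).
    + intros; now rewrite Rmult_0_l, sin_0.
    + assert (H := is_RInt_const 0 (2 * PI) 0).
      unfold scal in H; simpl in H. unfold mult in H; simpl in H.
      now rewrite Rmult_0_r in H.
  - assert (Hk' : IZR k <> 0) by now apply eq_IZR_contrapositive.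
    replace 0 with (minus (- cos (IZR k * (2 * PI)) / IZR k) (- cos (IZR k * 0) / IZR k)) at 2.
    + apply (is_RInt_derive (fun x => - cos (IZR k * x) / IZR k)).
      * intros x _. auto_derive; auto. field; auto.
      * intros x _. apply (ex_derive_continuous (fun x => sin (IZR k * x))).
        auto_derive; auto.
    + rewrite cos_2PI_Z, Rmult_0_r, cos_0. unfold minus, plus, opp; simpl. field; auto.
Qed.

Definition freq_energy (f : R -> R) (k : R) : R := cos_coef f k ^ 2 + sin_coef f k ^ 2.

(** The sum of the squared moduli of the unnormalised Fourier coefficients over |k| <= n, the
    frequencies k and -k of a real function being counted together. *)
Fixpoint partial_energy (f : R -> R) (n : nat) : R :=
  match n with
  | O => freq_energy f 0
  | S m => partial_energy f m + 2 * freq_energy f (INR n)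
  end.

(** The coefficients of the constant 1 vanish except at frequency 0, so the integral of f^2 enters
    only once. The value is twice the defect in Bessel's inequality at order n. *)
Lemma is_diff_RInt2_dirichlet (f : R -> R) (n : nat) : (forall x, continuous f x) ->
  is_diff_RInt2 f (dirichlet n)
    (4 * PI * RInt (fun x => f x ^ 2) 0 (2 * PI) - 2 * partial_energy f n).
Proof.
  intro Hf.
  assert (C1 : forall k : nat, cos_coef (fun _ => 1) (INR k) =
     if Z.eq_dec (Z.of_nat k) 0 then 2 * PI else 0).
  { intro k. apply is_RInt_unique. eapply is_RInt_ext_R; [|apply is_RInt_cos_Z].
    intros; cbv beta. rewrite <- INR_IZR_INZ. ring. }
  assert (S1 : forall k : nat, sin_coef (fun _ => 1) (INR k) = 0).
  { intro k. apply is_RInt_unique. eapply is_RInt_ext_R; [|apply (is_RInt_sin_Z (Z.of_nat k))].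
    intros; cbv beta. rewrite <- INR_IZR_INZ. ring. }
  induction n as [|n IH].
  - assert (H := is_diff_RInt2_cos f (INR 0) Hf). rewrite C1, S1 in H.
    change (INR 0) with 0 in H. change (Z.of_nat 0) with 0%Z in H.
    destruct (Z.eq_dec 0 0) as [_|E]; [|lia].
    replace (cos_coef (fun x => f x ^ 2) 0) with (RInt (fun x => f x ^ 2) 0 (2 * PI)) in H.
    2:{ apply RInt_ext. intros; now rewrite Rmult_0_l, cos_0, Rmult_1_r. }
    replace (4 * PI * RInt (fun x => f x ^ 2) 0 (2 * PI) - 2 * partial_energy f 0)
      with (2 * (2 * PI * RInt (fun x => f x ^ 2) 0 (2 * PI) + 0 * sin_coef (fun x => f x ^ 2) 0)
            - 2 * (cos_coef f 0 ^ 2 + sin_coef f 0 ^ 2))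
      by (simpl; unfold freq_energy; ring).
    eapply is_diff_RInt2_ext; [|exact H].
    intro d; simpl. now rewrite Rmult_0_l, cos_0.
  - assert (H := is_diff_RInt2_cos f (INR (S n)) Hf). rewrite C1, S1 in H.
    destruct (Z.eq_dec (Z.of_nat (S n)) 0) as [E|_]; [lia|].
    eapply is_diff_RInt2_ext.
    2:{ match type of H with is_diff_RInt2 _ _ ?v =>
        replace (4 * PI * RInt (fun x => f x ^ 2) 0 (2 * PI) - 2 * partial_energy f (S n))
         with (1 * (4 * PI * RInt (fun x => f x ^ 2) 0 (2 * PI) - 2 * partial_energy f n)
               + 2 * v) end.
        - exact (is_diff_RInt2_lin f _ _ 1 2 _ _ IH H).
        - change (partial_energy f (S n))
            with (partial_energy f n + 2 * freq_energy f (INR (S n))).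
          unfold freq_energy. ring. }
    intro d. change (dirichlet (S n) d) with (dirichlet n d + 2 * cos (INR (S n) * d)).
    cbv beta. ring.
Qed.

Lemma is_diff_RInt2_fejer (f : R -> R) (n : nat) : (forall x, continuous f x) ->
  is_diff_RInt2 f (fejer (S n))
    (sum_f_R0 (fun m => 4 * PI * RInt (fun x => f x ^ 2) 0 (2 * PI)
                        - 2 * partial_energy f m) n).
Proof.
  intro Hf. induction n as [|n IH].
  - eapply is_diff_RInt2_ext; [|exact (is_diff_RInt2_dirichlet f 0 Hf)].
    intro d; simpl; ring.
  - eapply is_diff_RInt2_ext.
    2:{ rewrite tech5. rewrite <- (Rmult_1_l (sum_f_R0 _ _)).
        rewrite <- (Rmult_1_l (_ - 2 * partial_energy f (S n))).
        exact (is_diff_RInt2_lin f _ _ 1 1 _ _ IH (is_diff_RInt2_dirichlet f (S n) Hf)). }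
    intro d. cbv beta.
    change (fejer (S (S n)) d) with (fejer (S n) d + dirichlet (S n) d). ring.
Qed.

Lemma periodic_C1_continuous (f : R -> R) : periodic_C1 f -> forall x, continuous f x.
Proof. intros [_ [H _]] x. apply (ex_derive_continuous f), H. Qed.

Lemma energy_defect_bounded (f : R -> R) : periodic_C1 f ->
  exists C, forall n,
    0 <= sum_f_R0 (fun m => 4 * PI * RInt (fun x => f x ^ 2) 0 (2 * PI)
                            - 2 * partial_energy f m) n <= C.
Proof.
  intro Hf. destruct (periodic_sq_diff_bound f Hf) as [K [HK Hb]].
  exists (2 * PI * (2 * PI * (2 * K))). intro n.
  apply (is_diff_RInt2_bound f (fejer (S n))).
  - intros x y Hx Hy. apply mul_fejer_bound; auto.
  - apply is_diff_RInt2_fejer. now apply periodic_C1_continuous.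
Qed.

(** The defects l - u m decrease, so (n + 1) (l - u n) is at most their sum up to n, hence at most
    C; this gives convergence at rate 1/n. Bessel's inequality u <= l need not be supplied: it
    follows from the lower bound on the sums. *)
Lemma incr_bounded_defect_lim (u : nat -> R) (l C : R) : (forall n, u n <= u (S n)) ->
  (forall n, 0 <= sum_f_R0 (fun m => l - u m) n <= C) -> is_lim_seq u l.
Proof.
  intros Hu HC.
  assert (Hmono : forall m k, u m <= u (m + k)%nat).
  { intros m k. induction k as [|k IH]; [rewrite Nat.add_0_r; lra|].
    rewrite Nat.add_succ_r. specialize (Hu (m + k)%nat). lra. }
  assert (Hle : forall m, u m <= l).
  { intro m. destruct (Rle_or_lt (u m) l) as [H|H]; auto. exfalso.
    (* If u m > l, every later defect is at most l - u m < 0, so the sums would tend to minus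
       infinity although they are nonnegative. *)
    assert (Hs : forall k, sum_f_R0 (fun m => l - u m) (m + k) <= C + INR k * (l - u m)).
    { intro k. induction k as [|k IH].
      - rewrite Nat.add_0_r. simpl. destruct (HC m). lra.
      - rewrite Nat.add_succ_r, tech5, S_INR.
        specialize (Hmono m (S k)). rewrite Nat.add_succ_r in Hmono. lra. }
    assert (HC0 : 0 <= C) by (destruct (HC 0%nat); lra).
    destruct (archimed_cor1 ((u m - l) / (C + 1))) as [N [HN HN0]].
    { apply Rdiv_lt_0_compat; lra. }
    assert (HNp : 0 < INR N) by now apply lt_0_INR.
    specialize (Hs N). destruct (HC (m + N)%nat) as [H0 _].
    assert (C + 1 < INR N * (u m - l)).
    { apply Rmult_lt_reg_r with (/ INR N); [now apply Rinv_0_lt_compat|].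
      replace (INR N * (u m - l) * / INR N) with (u m - l) by (field; lra).
      apply Rmult_lt_reg_r with (/ (C + 1)); [apply Rinv_0_lt_compat; lra|].
      replace ((C + 1) * / INR N * / (C + 1)) with (/ INR N) by (field; lra). exact HN. }
    lra. }
  assert (Hrate : forall n, INR (S n) * (l - u n) <= C).
  { intro n. apply Rle_trans with (2 := proj2 (HC n)).
    replace (INR (S n) * (l - u n)) with (sum_f_R0 (fun _ => l - u n) n)
      by (rewrite sum_cte; ring).
    apply sum_Rle. intros k Hk.
    specialize (Hmono k (n - k)%nat). replace (k + (n - k))%nat with n in Hmono by lia. lra. }
  apply is_lim_seq_le_le with (fun n => l - C * / INR (S n)) (fun _ => l).
  - intro n. split; auto. specialize (Hrate n).
    assert (Hp : 0 < INR (S n)) by (apply lt_0_INR; lia).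
    assert (l - u n <= C * / INR (S n)); [|lra].
    apply Rmult_le_reg_l with (INR (S n)); auto.
    replace (INR (S n) * (C * / INR (S n))) with C by (field; lra). exact Hrate.
  - replace (Finite l) with (Finite (l - C * 0)) by (f_equal; ring).
    apply is_lim_seq_minus'; [apply is_lim_seq_const|].
    apply is_lim_seq_mult'; [apply is_lim_seq_const|].
    apply is_lim_seq_incr_1 with (u := fun n => / INR n).
    replace (Finite 0) with (Rbar_inv p_infty) by reflexivity.
    apply is_lim_seq_inv; [apply is_lim_seq_INR|discriminate].
  - apply is_lim_seq_const.
Qed.

Lemma is_series_of_even_partial_sums (d : nat -> R) (l : R) : (forall n, 0 <= d n) ->
  is_lim_seq (fun n => sum_n d (2 * n)) l -> is_series d l.
Proof.
  intros Hd Hl.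
  assert (Hi := sum_n_nonneg_incr d Hd).
  assert (Hmono : forall n k, sum_n d n <= sum_n d (n + k)).
  { intros n k. induction k as [|k IH]; [rewrite Nat.add_0_r; lra|].
    rewrite Nat.add_succ_r. specialize (Hi (n + k)%nat). lra. }
  assert (Hb : forall n, sum_n d n <= l).
  { intro n. apply Rle_trans with (sum_n d (2 * n)).
    - replace (2 * n)%nat with (n + n)%nat by lia. apply Hmono.
    - apply (is_lim_seq_incr_compare (fun n => sum_n d (2 * n)) l Hl).
      intro m. replace (2 * S m)%nat with (2 * m + 2)%nat by lia. apply Hmono. }
  destruct (ex_finite_lim_seq_incr _ l Hi Hb) as [l' Hl'].
  assert (E : Finite l' = Finite l).
  { rewrite <- (is_lim_seq_unique _ _ Hl).
    symmetry. apply is_lim_seq_unique.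
    apply (is_lim_seq_subseq (sum_n d) l' (fun n => (2 * n)%nat)); auto.
    apply eventually_subseq. intro; lia. }
  injection E as <-. exact Hl'.
Qed.

(** The integral of g (theta) e^{-ik theta} over a period in real coordinates, not divided by 2 PI;
    hence the factors 2 PI in Parseval's identity below. *)
Definition fourier (k : Z) (g : R -> C) : C :=
  (cos_coef (fun x => Re (g x)) (IZR k) + sin_coef (fun x => Im (g x)) (IZR k),
   cos_coef (fun x => Im (g x)) (IZR k) - sin_coef (fun x => Re (g x)) (IZR k)).

Lemma Cmod_sqr (z : C) : Cmod z ^ 2 = Re z ^ 2 + Im z ^ 2.
Proof.
  unfold Cmod. rewrite <- Rsqr_pow2, Rsqr_sqrt; [reflexivity|].
  generalize (pow2_ge_0 (fst z)) (pow2_ge_0 (snd z)). lra.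
Qed.

Lemma cos_coef_opp (f : R -> R) (k : R) : cos_coef f (- k) = cos_coef f k.
Proof.
  apply RInt_ext. intros x _.
  now rewrite Ropp_mult_distr_l_reverse, cos_neg.
Qed.

Lemma sin_coef_opp (f : R -> R) (k : R) : (forall x, continuous f x) ->
  sin_coef f (- k) = - sin_coef f k.
Proof.
  intro Hf. apply is_RInt_unique.
  eapply is_RInt_ext_R; [|apply (is_RInt_opp _ _ _ _ (is_RInt_sin_coef f k Hf))].
  intros x. cbv beta. unfold opp; simpl.
  rewrite Ropp_mult_distr_l_reverse, sin_neg. ring.
Qed.

Lemma parseval (g : R -> C) :
  periodic_C1 (fun x => Re (g x)) -> periodic_C1 (fun x => Im (g x)) ->
  is_series (fun n => Cmod (fourier (int_enum n) g) ^ 2)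
    (2 * PI * RInt (fun x => Re (g x) ^ 2) 0 (2 * PI)
     + 2 * PI * RInt (fun x => Im (g x) ^ 2) 0 (2 * PI)).
Proof.
  intros Ha Hb.
  set (a := fun x => Re (g x)) in *. set (b := fun x => Im (g x)) in *.
  assert (Hac := periodic_C1_continuous a Ha). assert (Hbc := periodic_C1_continuous b Hb).
  set (d := fun n => Cmod (fourier (int_enum n) g) ^ 2).
  assert (Hd : forall n, 0 <= d n) by (intro; apply pow2_ge_0).
  (* The products mixing the real and imaginary parts of g have opposite signs at k and -k, so they
     cancel in the symmetric sum. *)
  assert (Hs : forall n, sum_n d (2 * n) = partial_energy a n + partial_energy b n).
  { induction n as [|n IH].
    - rewrite Nat.mul_0_r, sum_O. unfold d. rewrite Cmod_sqr.
      change (int_enum 0) with 0%Z. simpl. fold a b.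
      assert (Hz : forall f, sin_coef f 0 = 0).
      { intro f. apply is_RInt_unique. apply is_RInt_ext_R with (fun _ => 0).
        - intros; now rewrite Rmult_0_l, sin_0, Rmult_0_r.
        - assert (H := is_RInt_const 0 (2 * PI) 0).
          unfold scal in H; simpl in H. unfold mult in H; simpl in H.
          now rewrite Rmult_0_r in H. }
      unfold freq_energy. rewrite !Hz. ring.
    - replace (2 * S n)%nat with (S (S (2 * n))) by lia.
      rewrite !sum_Sn, IH.
      change (partial_energy ?f (S n)) with (partial_energy f n + 2 * freq_energy f (INR (S n))).
      change plus with Rplus.
      unfold d. rewrite !Cmod_sqr.
      replace (S (S (2 * n)))%nat with (2 * S n)%nat by lia.
      replace (S (2 * n)) with (2 * n + 1)%nat by lia.
      rewrite int_enum_even, int_enum_odd.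
      unfold fourier. fold a b. unfold Re, Im. cbn [fst snd].
      rewrite opp_IZR, !sin_coef_opp, !cos_coef_opp by auto.
      rewrite <- INR_IZR_INZ.
      unfold freq_energy. match goal with |- ?x = ?y => change (@eq R x y) end. ring. }
  apply is_series_of_even_partial_sums; auto.
  destruct (energy_defect_bounded a Ha) as [Ca HCa].
  destruct (energy_defect_bounded b Hb) as [Cb HCb].
  apply incr_bounded_defect_lim with ((Ca + Cb) / 2).
  - intro n. replace (2 * S n)%nat with (S (S (2 * n))) by lia.
    apply Rle_trans with (sum_n d (S (2 * n))); now apply sum_n_nonneg_incr.
  - intro n. specialize (HCa n). specialize (HCb n).
    match goal with |- 0 <= ?s <= _ => replace s with
      ((sum_f_R0 (fun m => 4 * PI * RInt (fun x => a x ^ 2) 0 (2 * PI) - 2 * partial_energy a m) n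
      + sum_f_R0 (fun m => 4 * PI * RInt (fun x => b x ^ 2) 0 (2 * PI) - 2 * partial_energy b m) n)
      / 2) end.
    + lra.
    + rewrite <- plus_sum. unfold Rdiv.
      rewrite Rmult_comm, scal_sum.
      apply sum_eq. intros i _. rewrite Hs. unfold a, b. field.
Qed.

(** * Fourier coefficients of solutions *)

Lemma smooth_d_x (u : R -> R -> C) : smooth u -> smooth (d_x u).
Proof. intros H n. apply (H (S n)). Qed.

Lemma smooth_d_th (u : R -> R -> C) : smooth u -> smooth (d_th u).
Proof. intros H n. apply (H (S n)). Qed.

Lemma smooth_ex_dC (u : R -> R -> C) (x th : R) : smooth u ->
  ex_dC (fun y => u y th) x /\ ex_dC (fun y => u x y) th.
Proof. intro H. apply (H 1%nat). Qed.

Lemma continuous_Re (q : C) : continuous Re q.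
Proof. apply (continuous_fst (U := R_UniformSpace) (V := R_UniformSpace)). Qed.

Lemma continuous_Im (q : C) : continuous Im q.
Proof. apply (continuous_snd (U := R_UniformSpace) (V := R_UniformSpace)). Qed.

Lemma smooth_continuity_2d (u : R -> R -> C) (x th : R) : smooth u ->
  continuity_2d_pt (fun y z => Re (u y z)) x th /\
  continuity_2d_pt (fun y z => Im (u y z)) x th.
Proof.
  intro H. assert (Hc := proj1 (H 0%nat) (x, th)).
  split; apply continuity_2d_pt_filterlim.
  - exact (continuous_comp _ Re _ Hc (continuous_Re _)).
  - exact (continuous_comp _ Im _ Hc (continuous_Im _)).
Qed.

Lemma smooth_slice (u : R -> R -> C) (x : R) (n : nat) : smooth u ->
  (forall th, ex_derive_n (fun y => Re (u x y)) n th) /\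
  (forall th, ex_derive_n (fun y => Im (u x y)) n th).
Proof.
  intro Hu.
  assert (Hit : forall m, smooth (Nat.iter m d_th u)).
  { induction m as [|m IH]; auto. now apply smooth_d_th. }
  assert (HRe : forall m, Derive_n (fun y => Re (u x y)) m = fun y => Re (Nat.iter m d_th u x y)).
  { induction m as [|m IH]; auto. simpl. now rewrite IH. }
  assert (HIm : forall m, Derive_n (fun y => Im (u x y)) m = fun y => Im (Nat.iter m d_th u x y)).
  { induction m as [|m IH]; auto. simpl. now rewrite IH. }
  destruct n as [|n]; [split; intro; exact I|].
  split; intro th; simpl; [rewrite HRe|rewrite HIm]; apply (smooth_ex_dC _ x th (Hit n)).
Qed.

Lemma smooth_bfun_slice (u : R -> R -> C) (f : bfun) : smooth u ->
  (forall x th, u x (th + 2 * PI) = u x th) ->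
  (forall s th, u (side s) th = f s th) -> smooth_bfun f.
Proof.
  intros Hu Hp Hf s. assert (E : f s = u (side s)).
  { apply functional_extensionality; intro; now rewrite Hf. }
  rewrite E. split; [auto|].
  intros n th. destruct (smooth_slice u (side s) n Hu). split; auto.
Qed.

Definition periodic_smooth (f : R -> R) : Prop :=
  (forall x, f (x + 2 * PI) = f x) /\ forall n x, ex_derive_n f n x.

Lemma periodic_smooth_slice (u : R -> R -> C) (x : R) : smooth u ->
  (forall x th, u x (th + 2 * PI) = u x th) ->
  periodic_smooth (fun th => Re (u x th)) /\ periodic_smooth (fun th => Im (u x th)).
Proof.
  intros Hu Hp; split; split.
  - intro; now rewrite Hp.
  - intros n. apply (proj1 (smooth_slice u x n Hu)).
  - intro; now rewrite Hp.
  - intros n. apply (proj2 (smooth_slice u x n Hu)).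
Qed.

Lemma periodic_smooth_bfun (f : bfun) (s : bool) : smooth_bfun f ->
  periodic_smooth (fun th => Re (f s th)) /\ periodic_smooth (fun th => Im (f s th)).
Proof.
  intro Hf. destruct (Hf s) as [Hp Hd]. split; split.
  - intro; now rewrite Hp.
  - intros n y; apply Hd.
  - intro; now rewrite Hp.
  - intros n y; apply Hd.
Qed.

Lemma periodic_smooth_C1 (f : R -> R) : periodic_smooth f -> periodic_C1 f.
Proof.
  intros [Hp Hd]. repeat split; auto.
  - intro x. exact (Hd 1%nat x).
  - intro x. apply (ex_derive_continuous (Derive f)). exact (Hd 2%nat x).
Qed.

Lemma periodic_smooth_Derive (f : R -> R) : periodic_smooth f -> periodic_smooth (Derive f).
Proof.
  intros [Hp Hd]. split.
  - intro x.
    rewrite <- (Derive_ext _ _ x Hp) at 1.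
    symmetry. apply is_derive_unique.
    assert (H := Derive_correct f (x + 2 * PI) (Hd 1%nat _)).
    auto_derive; [exact (ex_intro _ _ H)|].
    apply Rmult_1_l.
  - intros n x. specialize (Hd (S n) x).
    destruct n as [|n]; [exact I|]. simpl in Hd |- *.
    assert (E : forall m, Derive_n (Derive f) m = Derive (Derive_n f m)).
    { induction m as [|m IH]; auto. simpl. now rewrite IH. }
    now rewrite E.
Qed.

Lemma periodic_smooth_continuous (f : R -> R) : periodic_smooth f -> forall x, continuous f x.
Proof. intro H. now apply periodic_C1_continuous, periodic_smooth_C1. Qed.

Lemma cos_coef_lin (f g : R -> R) (a b k : R) :
  (forall x, continuous f x) -> (forall x, continuous g x) ->
  cos_coef (fun x => a * f x + b * g x) k = a * cos_coef f k + b * cos_coef g k.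
Proof.
  intros Hf Hg. apply is_RInt_unique.
  apply is_RInt_ext_R with (fun x => a * (f x * cos (k * x)) + b * (g x * cos (k * x))).
  - intro; ring.
  - apply is_RInt_lin; now apply is_RInt_cos_coef.
Qed.

Lemma sin_coef_lin (f g : R -> R) (a b k : R) :
  (forall x, continuous f x) -> (forall x, continuous g x) ->
  sin_coef (fun x => a * f x + b * g x) k = a * sin_coef f k + b * sin_coef g k.
Proof.
  intros Hf Hg. apply is_RInt_unique.
  apply is_RInt_ext_R with (fun x => a * (f x * sin (k * x)) + b * (g x * sin (k * x))).
  - intro; ring.
  - apply is_RInt_lin; now apply is_RInt_sin_coef.
Qed.

(** Integration by parts over a period; the boundary terms cancel by periodicity because k is an
    integer. *)
Lemma cos_sin_coef_Derive (f : R -> R) (k : Z) : periodic_smooth f ->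
  cos_coef (Derive f) (IZR k) = IZR k * sin_coef f (IZR k) /\
  sin_coef (Derive f) (IZR k) = - IZR k * cos_coef f (IZR k).
Proof.
  intro Hf. assert (Hc := periodic_smooth_continuous f Hf).
  assert (Hdc := periodic_smooth_continuous _ (periodic_smooth_Derive f Hf)).
  destruct Hf as [Hp Hd].
  assert (Hd1 : forall x, is_derive f x (Derive f x)).
  { intro x. apply Derive_correct. exact (Hd 1%nat x). }
  assert (Hex : forall x, ex_derive f x) by (intro x; exact (Hd 1%nat x)).
  assert (Hper : f (2 * PI) = f 0) by (rewrite <- (Hp 0); f_equal; ring).
  assert (Hcos : forall x, continuous (fun x => cos (IZR k * x)) x).
  { intro x. apply (ex_derive_continuous (fun x => cos (IZR k * x))). auto_derive; auto. }
  assert (Hsin : forall x, continuous (fun x => sin (IZR k * x)) x).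
  { intro x. apply (ex_derive_continuous (fun x => sin (IZR k * x))). auto_derive; auto. }
  assert (A1 := is_RInt_cos_coef f (IZR k) Hc). assert (B1 := is_RInt_sin_coef f (IZR k) Hc).
  split; apply is_RInt_unique.
  - assert (H : is_RInt (fun x => Derive f x * cos (IZR k * x) + - IZR k * (f x * sin (IZR k * x)))
       0 (2 * PI) (minus (f (2 * PI) * cos (IZR k * (2 * PI))) (f 0 * cos (IZR k * 0)))).
    { apply (is_RInt_derive (fun x => f x * cos (IZR k * x))).
      - intros x _. auto_derive; [auto|].
        change (fun x => f x) with f. ring.
      - intros x _. apply (continuous_plus (fun x => Derive f x * cos (IZR k * x))).
        + now apply (continuous_mult (Derive f)).
        + apply (continuous_scal_r (- IZR k) (fun x => f x * sin (IZR k * x))).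
          now apply (continuous_mult f). }
    rewrite cos_2PI_Z, Hper, Rmult_0_r, cos_0, minus_eq_zero in H.
    replace (IZR k * sin_coef f (IZR k)) with (1 * 0 + IZR k * sin_coef f (IZR k)) by ring.
    eapply is_RInt_ext_R; [|exact (is_RInt_lin _ _ 1 (IZR k) _ _ _ _ H B1)].
    intro x; cbv beta. ring.
  - assert (H : is_RInt (fun x => Derive f x * sin (IZR k * x) + IZR k * (f x * cos (IZR k * x)))
       0 (2 * PI) (minus (f (2 * PI) * sin (IZR k * (2 * PI))) (f 0 * sin (IZR k * 0)))).
    { apply (is_RInt_derive (fun x => f x * sin (IZR k * x))).
      - intros x _. auto_derive; [auto|].
        change (fun x => f x) with f. ring.
      - intros x _. apply (continuous_plus (fun x => Derive f x * sin (IZR k * x))).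
        + now apply (continuous_mult (Derive f)).
        + apply (continuous_scal_r (IZR k) (fun x => f x * cos (IZR k * x))).
          now apply (continuous_mult f). }
    rewrite sin_2PI_Z, Hper, (Rmult_0_r (IZR k)), sin_0, minus_eq_zero in H.
    replace (- IZR k * cos_coef f (IZR k)) with (1 * 0 + - IZR k * cos_coef f (IZR k)) by ring.
    eapply is_RInt_ext_R; [|exact (is_RInt_lin _ _ 1 (- IZR k) _ _ _ _ H A1)].
    intro x; cbv beta. ring.
Qed.

Lemma Cinv_Ci : (/ Ci)%C = (0, -1).
Proof. unfold Cinv, Ci; simpl. f_equal; field. Qed.

(** Written as a * f + b * g, the shape expected by [cos_coef_lin], [sin_coef_lin] and
    [periodic_smooth_lin]. *)
Lemma magnetic_d_Re (nu : R) (u : R -> R -> C) (x th : R) :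
  Re (magnetic_d nu u x th) =
    1 * Derive (fun y => Im (u x y)) th + - nu * Re (u x th).
Proof.
  unfold magnetic_d. rewrite Cinv_Ci. unfold d_th, dC, Re, Im; simpl. ring.
Qed.

Lemma magnetic_d_Im (nu : R) (u : R -> R -> C) (x th : R) :
  Im (magnetic_d nu u x th) =
    -1 * Derive (fun y => Re (u x y)) th + - nu * Im (u x th).
Proof.
  unfold magnetic_d. rewrite Cinv_Ci. unfold d_th, dC, Re, Im; simpl. ring.
Qed.

Lemma fourier_magnetic_d (nu : R) (u : R -> R -> C) (x : R) (k : Z) :
  periodic_smooth (fun th => Re (u x th)) -> periodic_smooth (fun th => Im (u x th)) ->
  fourier k (magnetic_d nu u x) = (RtoC (IZR k - nu) * fourier k (u x))%C.
Proof.
  intros Ha Hb. unfold fourier.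
  assert (Hac := periodic_smooth_continuous _ Ha).
  assert (Hbc := periodic_smooth_continuous _ Hb).
  assert (Hac' := periodic_smooth_continuous _ (periodic_smooth_Derive _ Ha)).
  assert (Hbc' := periodic_smooth_continuous _ (periodic_smooth_Derive _ Hb)).
  rewrite (functional_extensionality _ _ (magnetic_d_Re nu u x)),
    (functional_extensionality _ _ (magnetic_d_Im nu u x)).
  rewrite !cos_coef_lin, !sin_coef_lin by auto.
  destruct (cos_sin_coef_Derive _ k Ha) as [-> ->].
  destruct (cos_sin_coef_Derive _ k Hb) as [-> ->].
  unfold Cmult, RtoC; simpl. f_equal; ring.
Qed.

Lemma periodic_smooth_lin (f g : R -> R) (a b : R) :
  periodic_smooth f -> periodic_smooth g -> periodic_smooth (fun x => a * f x + b * g x).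
Proof.
  intros [Hf1 Hf2] [Hg1 Hg2]. split.
  - intro x. now rewrite Hf1, Hg1.
  - intros n x. apply ex_derive_n_plus.
    + apply filter_forall. intros y m _. now apply ex_derive_n_scal_l.
    + apply filter_forall. intros y m _. now apply ex_derive_n_scal_l.
Qed.

Lemma fourier_magnetic_d2 (nu : R) (u : R -> R -> C) (x : R) (k : Z) :
  periodic_smooth (fun th => Re (u x th)) -> periodic_smooth (fun th => Im (u x th)) ->
  fourier k (magnetic_d nu (magnetic_d nu u) x)
    = (RtoC ((IZR k - nu) ^ 2) * fourier k (u x))%C.
Proof.
  intros Ha Hb. rewrite !fourier_magnetic_d; auto.
  - rewrite Cmult_assoc, <- RtoC_mult. repeat f_equal. ring.
  - rewrite (functional_extensionality _ _ (magnetic_d_Re nu u x)).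
    apply periodic_smooth_lin; auto. now apply periodic_smooth_Derive.
  - rewrite (functional_extensionality _ _ (magnetic_d_Im nu u x)).
    apply periodic_smooth_lin; auto. now apply periodic_smooth_Derive.
Qed.

Lemma continuity_2d_pt_slice (w : R -> R -> R) (x y : R) :
  continuity_2d_pt w x y -> continuous (w x) y.
Proof.
  intros H P [eps HP]. destruct (H eps) as [d Hd].
  exists d. intros z Hz. apply HP. apply Hd; auto.
  rewrite Rminus_diag, Rabs_R0. apply cond_pos.
Qed.

(** Differentiation under the integral sign. The weight [e] stands for cos (k theta) or sin (k
    theta), which covers the four real integrals that make up [fourier]. *)
Lemma is_derive_RInt_weight (w : R -> R -> R) (e : R -> R) (x a b : R) :
  (forall y z, ex_derive (fun t => w t z) y) ->
  (forall y z, continuity_2d_pt w y z) ->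
  (forall y z, continuity_2d_pt (fun y z => Derive (fun t => w t z) y) y z) ->
  (forall z, continuous e z) ->
  is_derive (fun y => RInt (fun z => w y z * e z) a b) x
    (RInt (fun z => Derive (fun t => w t z) x * e z) a b).
Proof.
  intros Hd Hc Hdc He.
  assert (Hde : forall y z, Derive (fun t => w t z * e z) y = Derive (fun t => w t z) y * e z).
  { intros y z. apply Derive_scal_l. }
  rewrite (RInt_ext _ (fun z => Derive (fun t => w t z * e z) x))
    by (intros; now rewrite Hde).
  apply (is_derive_RInt_param (fun y z => w y z * e z)).
  - apply filter_forall. intros y z _. apply (ex_derive_mult (fun t => w t z) (fun _ => e z));
      [apply Hd|apply ex_derive_const].
  - intros z _. apply continuity_2d_pt_ext with (fun y z => Derive (fun t => w t z) y * e z).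
    + intros; now rewrite Hde.
    + apply continuity_2d_pt_mult; [apply Hdc|].
      apply (continuity_1d_2d_pt_comp e (fun _ z => z)).
      * apply continuity_pt_filterlim, He.
      * apply continuity_2d_pt_id2.
  - apply filter_forall. intro y. apply (ex_RInt_continuous (V := R_CompleteNormedModule)). intros z _.
    apply (continuous_mult (w y)); auto. now apply continuity_2d_pt_slice.
Qed.

Lemma is_derive_fourier (u : R -> R -> C) (k : Z) (x : R) : smooth u ->
  is_derive (fun y => Re (fourier k (u y))) x (Re (fourier k (d_x u x))) /\
  is_derive (fun y => Im (fourier k (u y))) x (Im (fourier k (d_x u x))).
Proof.
  intro Hu. assert (Hdu := smooth_d_x u Hu).
  assert (Hcos : forall z, continuous (fun z => cos (IZR k * z)) z).
  { intro z. apply (ex_derive_continuous (fun x => cos (IZR k * x))). auto_derive; auto. }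
  assert (Hsin : forall z, continuous (fun z => sin (IZR k * z)) z).
  { intro z. apply (ex_derive_continuous (fun x => sin (IZR k * x))). auto_derive; auto. }
  assert (HRe : forall e, (forall z, continuous e z) ->
    is_derive (fun y => RInt (fun z => Re (u y z) * e z) 0 (2 * PI)) x
      (RInt (fun z => Re (d_x u x z) * e z) 0 (2 * PI))).
  { intros e He. apply (is_derive_RInt_weight (fun y z => Re (u y z))); auto.
    - intros y z. apply (smooth_ex_dC u y z Hu).
    - intros y z. now apply smooth_continuity_2d.
    - intros y z. apply (smooth_continuity_2d (d_x u) y z Hdu). }
  assert (HIm : forall e, (forall z, continuous e z) ->
    is_derive (fun y => RInt (fun z => Im (u y z) * e z) 0 (2 * PI)) x
      (RInt (fun z => Im (d_x u x z) * e z) 0 (2 * PI))).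
  { intros e He. apply (is_derive_RInt_weight (fun y z => Im (u y z))); auto.
    - intros y z. apply (smooth_ex_dC u y z Hu).
    - intros y z. now apply smooth_continuity_2d.
    - intros y z. apply (smooth_continuity_2d (d_x u) y z Hdu). }
  split.
  - exact (is_derive_plus _ _ _ _ _ (HRe _ Hcos) (HIm _ Hsin)).
  - exact (is_derive_minus _ _ _ _ _ (HIm _ Hcos) (HRe _ Hsin)).
Qed.

(** On frequency k the magnetic derivative acts as multiplication by k - nu, so the equation becomes
    the ODE p'' = (k - nu)^2 p. *)
Lemma fourier_d_x2 (nu : R) (u : R -> R -> C) (k : Z) (x : R) : smooth u ->
  (forall x th, u x (th + 2 * PI) = u x th) ->
  (forall th, magnetic_laplacian nu u x th = RtoC 0) ->
  fourier k (d_x (d_x u) x) = (RtoC ((IZR k - nu) ^ 2) * fourier k (u x))%C.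
Proof.
  intros Hu Hp H.
  destruct (periodic_smooth_slice u x Hu Hp) as [Ha Hb].
  rewrite <- fourier_magnetic_d2 by auto. f_equal.
  apply functional_extensionality; intro th.
  specialize (H th). unfold magnetic_laplacian in H.
  replace (d_x (d_x u) x th) with (d_x (d_x u) x th + RtoC 0)%C by ring.
  rewrite <- H. ring.
Qed.

(** * Eigenfunctions against the explicit modes *)

Lemma wronskian_constant (p p1 q q1 : R -> R) (c : R) :
  (forall x, is_derive p x (p1 x)) -> (forall x, ex_derive p1 x) ->
  (forall x, -1 < x < 1 -> is_derive p1 x (c * p x)) ->
  (forall x, is_derive q x (q1 x)) -> (forall x, is_derive q1 x (c * q x)) ->
  p1 1 * q 1 - p 1 * q1 1 = p1 (-1) * q (-1) - p (-1) * q1 (-1).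
Proof.
  intros Hp Hp1 Hp2 Hq Hq1.
  destruct (MVT_gen (fun x => p1 x * q x - p x * q1 x) (-1) 1 (fun _ => 0)) as [z [_ E]].
  - intros x Hx. rewrite Rmin_left, Rmax_right in Hx by lra.
    assert (H1 := Hp2 x Hx). assert (H2 := Hp x). assert (H3 := Hq x). assert (H4 := Hq1 x).
    assert (E1 := is_derive_unique _ _ _ H1). assert (E2 := is_derive_unique _ _ _ H2).
    assert (E3 := is_derive_unique _ _ _ H3). assert (E4 := is_derive_unique _ _ _ H4).
    auto_derive.
    + repeat split; eexists; eassumption.
    + change (fun x => p1 x) with p1. change (fun x => p x) with p.
      change (fun x => q1 x) with q1. change (fun x => q x) with q.
      rewrite E1, E2, E3, E4. ring.
  (* The equation for p holds only in the open interval; the mean value theorem needs no more than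
     continuity at the endpoints, which differentiability of p and p1 provides. *)
  - intros x _. apply continuity_pt_filterlim.
    apply (ex_derive_continuous (fun x => p1 x * q x - p x * q1 x)).
    auto_derive. repeat split; auto; eexists; auto.
  - lra.
Qed.

(** Equal coefficients on the two circles mean orthogonality to the odd mode of frequency k,
    opposite coefficients orthogonality to the even one. *)
Lemma DN_eigen_fourier (nu lam : R) (phi : bfun) (k : Z) :
  DN nu phi (fun s th => RtoC lam * phi s th)%C ->
  (lam <> lambda_plus nu k -> IZR k - nu <> 0 ->
     fourier k (phi true) = fourier k (phi false)) /\
  (lam <> lambda_minus nu k -> fourier k (phi true) = (- fourier k (phi false))%C).
Proof.
  intros [u [Hu [Hp [Heq [Hf Hg]]]]].
  set (kap := IZR k - nu).
  assert (Hdu := smooth_d_x u Hu).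
  assert (Ef : forall s, phi s = u (side s)).
  { intro s. apply functional_extensionality; intro; now rewrite Hf. }
  assert (Hlin : forall (r : R) (g : R -> C),
     (forall x, continuous (fun x => Re (g x)) x) -> (forall x, continuous (fun x => Im (g x)) x) ->
     fourier k (fun th => RtoC r * g th)%C = (RtoC r * fourier k g)%C).
  { intros r g Ha Hb. unfold fourier.
    rewrite (functional_extensionality (fun x => Re (RtoC r * g x)%C)
               (fun x => r * Re (g x) + 0 * Re (g x)))
      by (intro; unfold Cmult, RtoC, Re; simpl; ring).
    rewrite (functional_extensionality (fun x => Im (RtoC r * g x)%C)
               (fun x => r * Im (g x) + 0 * Im (g x)))
      by (intro; unfold Cmult, RtoC, Im; simpl; ring).
    rewrite !cos_coef_lin, !sin_coef_lin by auto.
    unfold Cmult, RtoC; simpl. f_equal; ring. }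
  assert (Hc : forall v, smooth v -> forall x y, continuous (fun x0 => Re (v x x0)) y /\
                continuous (fun x0 => Im (v x x0)) y).
  { intros v Hv x y. destruct (smooth_continuity_2d v x y Hv).
    split; [apply (continuity_2d_pt_slice (fun y z => Re (v y z)))
           |apply (continuity_2d_pt_slice (fun y z => Im (v y z)))]; auto. }
  assert (Hbd : forall s, (RtoC lam * fourier k (u (side s)))%C
                  = (RtoC (side s) * fourier k (d_x u (side s)))%C).
  { intro s. rewrite <- (Hlin lam (u (side s)) (fun y => proj1 (Hc u Hu (side s) y))
                 (fun y => proj2 (Hc u Hu (side s) y))).
    rewrite <- (Hlin (side s) (d_x u (side s)) (fun y => proj1 (Hc _ Hdu (side s) y))
                 (fun y => proj2 (Hc _ Hdu (side s) y))).
    f_equal. apply functional_extensionality; intro th. now rewrite <- Hg, Hf. }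
  assert (Hb1 := Hbd true). assert (Hb2 := Hbd false).
  rewrite !Ef. simpl side in *.
  assert (HD2 : forall x, -1 < x < 1 ->
    fourier k (d_x (d_x u) x) = (RtoC (kap ^ 2) * fourier k (u x))%C).
  { intros x Hx. apply fourier_d_x2; auto. }
  (* The real and imaginary parts of the Fourier coefficient both solve p'' = kap^2 p on
     (-1,1); this treats them at once. *)
  assert (Hcomp : forall (c : C -> R),
     (forall r z, c (RtoC r * z)%C = r * c z) ->
     (forall v x, smooth v -> is_derive (fun y => c (fourier k (v y))) x (c (fourier k (d_x v x)))) ->
     (lam <> lambda_plus nu k -> kap <> 0 -> c (fourier k (u 1)) = c (fourier k (u (-1)))) /\
     (lam <> lambda_minus nu k -> c (fourier k (u 1)) = - c (fourier k (u (-1))))).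
  { intros c Hcs Hcd.
    assert (E1 := f_equal c Hb1). assert (E2 := f_equal c Hb2). rewrite !Hcs in E1, E2.
    assert (HODE : forall x, -1 < x < 1 ->
      is_derive (fun x => c (fourier k (d_x u x))) x (kap ^ 2 * c (fourier k (u x)))).
    { intros x Hx. rewrite <- Hcs, <- HD2 by auto. now apply Hcd. }
    assert (HW' := fun q q1 => wronskian_constant (fun x => c (fourier k (u x)))
       (fun x => c (fourier k (d_x u x))) q q1 (kap ^ 2)
       (fun x => Hcd u x Hu) (fun x => ex_intro _ _ (Hcd (d_x u) x Hdu)) HODE).
    cbv beta in HW'.
    set (p := c (fourier k (u 1))) in *. set (p' := c (fourier k (d_x u 1))) in *.
    set (m := c (fourier k (u (-1)))) in *. set (m' := c (fourier k (d_x u (-1)))) in *.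
    (* The eigenvalue condition at the two ends; the outward normal at -1 points to the left, hence
       the sign in m' = - lam m. *)
    replace p' with (lam * p) in HW' by lra.
    replace m' with (- lam * m) in HW' by lra.
    assert (Hch : cosh (kap * -1) = cosh (kap * 1)).
    { unfold cosh. rewrite Rmult_1_r. replace (kap * -1) with (- kap) by ring.
      rewrite Ropp_involutive. field. }
    assert (Hsh : sinh (kap * -1) = - sinh (kap * 1)).
    { unfold sinh. rewrite Rmult_1_r. replace (kap * -1) with (- kap) by ring.
      rewrite Ropp_involutive. field. }
    split.
    - intros Hl Hk.
      (* Against the odd solution, equality of the Wronskians at 1 and -1 factors as (lam sinh kap -
         kap cosh kap) (p - m) = 0. *)
      assert (W := HW' (fun x => sinh (kap * x)) (fun x => kap * cosh (kap * x))
        ltac:(intro; auto_derive; auto; ring) ltac:(intro; auto_derive; auto; ring)).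
      cbv beta in W. rewrite Hch, Hsh, !Rmult_1_r in W.
      assert (Hs := sinh_neq_0 kap Hk).
      destruct (Req_dec p m) as [|Hpm]; auto. exfalso. apply Hl.
      unfold lambda_plus, coth. fold kap.
      apply Rmult_eq_reg_r with (sinh kap * (p - m)).
      + replace (kap * (cosh kap / sinh kap) * (sinh kap * (p - m)))
          with (kap * cosh kap * (p - m)) by (field; auto). lra.
      + apply Rmult_integral_contrapositive. split; auto. lra.
    - intros Hl.
      (* Against the even solution it factors as (lam cosh kap - kap sinh kap) (p + m) = 0. *)
      assert (W := HW' (fun x => cosh (kap * x)) (fun x => kap * sinh (kap * x))
        ltac:(intro; auto_derive; auto; ring) ltac:(intro; auto_derive; auto; ring)).
      cbv beta in W. rewrite Hch, Hsh, !Rmult_1_r in W.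
      assert (Hs : cosh kap <> 0) by (generalize (cosh_pos kap); lra).
      destruct (Req_dec p (- m)) as [|Hpm]; auto. exfalso. apply Hl.
      unfold lambda_minus, tanh. fold kap.
      apply Rmult_eq_reg_r with (cosh kap * (p + m)).
      + replace (kap * (sinh kap / cosh kap) * (cosh kap * (p + m)))
          with (kap * sinh kap * (p + m)) by (field; auto). lra.
      + apply Rmult_integral_contrapositive. split; auto. lra. }
  destruct (Hcomp Re) as [R1 R2].
  { intros; unfold Cmult, RtoC, Re; simpl; ring. }
  { intros v x Hv; exact (proj1 (is_derive_fourier v k x Hv)). }
  destruct (Hcomp Im) as [I1 I2].
  { intros; unfold Cmult, RtoC, Im; simpl; ring. }
  { intros v x Hv; exact (proj2 (is_derive_fourier v k x Hv)). }
  split.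
  - intros Hl Hk. apply injective_projections; [now apply R1|now apply I1].
  - intros Hl. apply injective_projections; [now apply R2|now apply I2].
Qed.

(** * Explicit eigenfunctions *)

(** Exponentials rather than cosh and sinh: every derivative then acts diagonally on the pair of
    coefficients, and the odd and even solutions are both special cases. *)
Definition hyp (al be k x : R) : R := al * exp (k * x) + be * exp (- k * x).

(* ((a e^{kap x} + b e^{-kap x}) + i (c e^{kap x} + d e^{-kap x})) e^{i k theta} *)
Definition mode (kap k a b c d : R) : R -> R -> C := fun x th =>
  (hyp a b kap x * cos (k * th) - hyp c d kap x * sin (k * th),
   hyp a b kap x * sin (k * th) + hyp c d kap x * cos (k * th)).

Lemma is_derive_hyp (al be k x : R) :
  is_derive (hyp al be k) x (hyp (k * al) (- k * be) k x).
Proof. unfold hyp. auto_derive; auto. ring. Qed.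

Lemma is_derive_mode_x (kap k a b c d x th : R) :
  is_derive (fun y => Re (mode kap k a b c d y th)) x
    (Re (mode kap k (kap * a) (- kap * b) (kap * c) (- kap * d) x th)) /\
  is_derive (fun y => Im (mode kap k a b c d y th)) x
    (Im (mode kap k (kap * a) (- kap * b) (kap * c) (- kap * d) x th)).
Proof. split; unfold mode, hyp, Re, Im; simpl; auto_derive; auto; ring. Qed.

Lemma is_derive_mode_th (kap k a b c d x th : R) :
  is_derive (fun y => Re (mode kap k a b c d x y)) th
    (Re (mode kap k (- k * c) (- k * d) (k * a) (k * b) x th)) /\
  is_derive (fun y => Im (mode kap k a b c d x y)) th
    (Im (mode kap k (- k * c) (- k * d) (k * a) (k * b) x th)).
Proof. split; unfold mode, hyp, Re, Im; simpl; auto_derive; auto; ring. Qed.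

Lemma d_x_mode (kap k a b c d : R) :
  d_x (mode kap k a b c d) = mode kap k (kap * a) (- kap * b) (kap * c) (- kap * d).
Proof.
  apply functional_extensionality; intro x. apply functional_extensionality; intro th.
  destruct (is_derive_mode_x kap k a b c d x th) as [H1 H2].
  apply injective_projections; now apply is_derive_unique.
Qed.

Lemma d_th_mode (kap k a b c d : R) :
  d_th (mode kap k a b c d) = mode kap k (- k * c) (- k * d) (k * a) (k * b).
Proof.
  apply functional_extensionality; intro x. apply functional_extensionality; intro th.
  destruct (is_derive_mode_th kap k a b c d x th) as [H1 H2].
  apply injective_projections; now apply is_derive_unique.
Qed.

Lemma continuous_pair_C {T : UniformSpace} (f g : T -> R) (p : T) :
  continuous f p -> continuous g p -> continuous (fun q => (f q, g q) : C) p.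
Proof.
  intros Hf Hg P [eps HP].
  apply (filter_imp (F := locally p)) with (fun q => ball (f p) eps (f q) /\ ball (g p) eps (g q)).
  - intros q Hq. apply HP. exact Hq.
  - apply filter_and; [apply (Hf (ball (f p) eps))|apply (Hg (ball (g p) eps))];
      now exists eps.
Qed.

Lemma continuous_mode (kap k a b c d : R) (p : R * R) :
  continuous (fun q : R * R => mode kap k a b c d (fst q) (snd q)) p.
Proof.
  assert (Hx : forall al be, continuous (fun q : R * R => hyp al be kap (fst q)) p).
  { intros al be. apply (continuous_comp fst (hyp al be kap)); [apply continuous_fst|].
    apply (ex_derive_continuous (hyp al be kap)). eexists; apply is_derive_hyp. }
  assert (Hc : continuous (fun q : R * R => cos (k * snd q)) p).
  { apply (continuous_comp snd (fun y => cos (k * y))); [apply continuous_snd|].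
    apply (ex_derive_continuous (fun y => cos (k * y))). auto_derive; auto. }
  assert (Hs : continuous (fun q : R * R => sin (k * snd q)) p).
  { apply (continuous_comp snd (fun y => sin (k * y))); [apply continuous_snd|].
    apply (ex_derive_continuous (fun y => sin (k * y))). auto_derive; auto. }
  apply continuous_pair_C.
  - apply (continuous_minus (fun q : R * R => hyp a b kap (fst q) * cos (k * snd q))
             (fun q => hyp c d kap (fst q) * sin (k * snd q))).
    + exact (continuous_mult _ _ _ (Hx a b) Hc).
    + exact (continuous_mult _ _ _ (Hx c d) Hs).
  - apply (continuous_plus (fun q : R * R => hyp a b kap (fst q) * sin (k * snd q))
             (fun q => hyp c d kap (fst q) * cos (k * snd q))).
    + exact (continuous_mult _ _ _ (Hx a b) Hs).
    + exact (continuous_mult _ _ _ (Hx c d) Hc).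
Qed.

(** Modes are closed under [d_x] and [d_th], so the induction must range over all coefficients at
    once. *)
Lemma smooth_mode (kap k a b c d : R) : smooth (mode kap k a b c d).
Proof.
  intro n. revert a b c d. induction n as [|n IH]; intros a b c d; simpl.
  - split; auto. intro p. apply continuous_mode.
  - split; [intro p; apply continuous_mode|]. split.
    + intros x th.
      destruct (is_derive_mode_x kap k a b c d x th) as [H1 H2].
      destruct (is_derive_mode_th kap k a b c d x th) as [H3 H4].
      split; split; eexists; eassumption.
    + rewrite d_x_mode, d_th_mode. split; apply IH.
Qed.

Lemma magnetic_d_mode (nu kap k a b c d : R) :
  magnetic_d nu (mode kap k a b c d)
    = mode kap k ((k - nu) * a) ((k - nu) * b) ((k - nu) * c) ((k - nu) * d).
Proof.
  apply functional_extensionality; intro x. apply functional_extensionality; intro th.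
  unfold magnetic_d. rewrite Cinv_Ci, d_th_mode.
  unfold mode, hyp, Cmult, Cminus, Cplus, Copp, RtoC; simpl. f_equal; ring.
Qed.

Lemma magnetic_laplacian_mode (nu kap k a b c d x th : R) : kap = k - nu ->
  magnetic_laplacian nu (mode kap k a b c d) x th = RtoC 0.
Proof.
  intros ->. unfold magnetic_laplacian. rewrite !d_x_mode, !magnetic_d_mode.
  unfold mode, hyp, Cplus, Copp, RtoC; simpl. f_equal; ring.
Qed.

Definition boundary_sign (plus : bool) (s : bool) : R := if plus then side s else 1.

Definition boundary_mode (plus : bool) (k : Z) : bfun := fun s th =>
  (boundary_sign plus s / sqrt (4 * PI) * cos (IZR k * th),
   boundary_sign plus s / sqrt (4 * PI) * sin (IZR k * th)).

Definition eigenvalue (nu : R) (plus : bool) (k : Z) : R :=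
  if plus then lambda_plus nu k else lambda_minus nu k.

Lemma periodic_mode (kap a b c d x th : R) (k : Z) :
  mode kap (IZR k) a b c d x (th + 2 * PI) = mode kap (IZR k) a b c d x th.
Proof.
  unfold mode. rewrite Rmult_plus_distr_l, cos_plus, sin_plus, cos_2PI_Z, sin_2PI_Z.
  f_equal; ring.
Qed.

Lemma DN_mode (nu kap a b : R) (k : Z) (f g : bfun) : kap = IZR k - nu ->
  (forall s th, f s th = mode kap (IZR k) a b 0 0 (side s) th) ->
  (forall s th, g s th = (RtoC (side s) *
      mode kap (IZR k) (kap * a) (- kap * b) 0 0 (side s) th)%C) ->
  DN nu f g.
Proof.
  intros Hk Hf Hg. exists (mode kap (IZR k) a b 0 0). repeat split.
  - apply smooth_mode.
  - intros; apply periodic_mode.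
  - intros x th _. now apply magnetic_laplacian_mode.
  - intros; now rewrite Hf.
  - intros. rewrite Hg, d_x_mode. now rewrite !Rmult_0_r.
Qed.

Lemma DN_boundary_mode (nu : R) (plus : bool) (k : Z) : IZR k - nu <> 0 ->
  DN nu (boundary_mode plus k)
    (fun s th => RtoC (eigenvalue nu plus k) * boundary_mode plus k s th)%C.
Proof.
  intro Hk. set (kap := IZR k - nu) in *.
  assert (H4 : sqrt (4 * PI) <> 0).
  { assert (0 < sqrt (4 * PI)) by (apply sqrt_lt_R0; generalize PI_RGT_0; lra). lra. }
  assert (Hsh := sinh_neq_0 kap Hk). assert (Hch := cosh_pos kap).
  assert (Es : exp kap = cosh kap + sinh kap) by (unfold cosh, sinh; field).
  assert (Ec : exp (- kap) = cosh kap - sinh kap) by (unfold cosh, sinh; field).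
  destruct plus.
  (* The coefficients of sinh (kap x) / (sinh kap * sqrt (4 PI)), the odd solution that equals 1 /
     sqrt (4 PI) at x = 1. *)
  - apply DN_mode with kap (/ (2 * sinh kap * sqrt (4 * PI)))
      (- / (2 * sinh kap * sqrt (4 * PI))) k; auto.
    + intros [|] th; unfold boundary_mode, boundary_sign, mode, hyp, side;
        replace (kap * 1) with kap by ring; replace (- kap * 1) with (- kap) by ring;
        replace (kap * -1) with (- kap) by ring; replace (- kap * -1) with kap by ring;
        rewrite Es, Ec; f_equal; field; auto.
    + intros [|] th; unfold boundary_mode, boundary_sign, mode, hyp, side, eigenvalue,
        lambda_plus, coth; fold kap;
        replace (kap * 1) with kap by ring; replace (- kap * 1) with (- kap) by ring;
        replace (kap * -1) with (- kap) by ring; replace (- kap * -1) with kap by ring;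
        rewrite Es, Ec; unfold Cmult, RtoC; simpl; f_equal; field; auto.
  (* The coefficients of cosh (kap x) / (cosh kap * sqrt (4 PI)), the even solution. *)
  - apply DN_mode with kap (/ (2 * cosh kap * sqrt (4 * PI)))
      (/ (2 * cosh kap * sqrt (4 * PI))) k; auto.
    + intros [|] th; unfold boundary_mode, boundary_sign, mode, hyp, side;
        replace (kap * 1) with kap by ring; replace (- kap * 1) with (- kap) by ring;
        replace (kap * -1) with (- kap) by ring; replace (- kap * -1) with kap by ring;
        rewrite Es, Ec; f_equal; field; split; auto; lra.
    + intros [|] th; unfold boundary_mode, boundary_sign, mode, hyp, side, eigenvalue,
        lambda_minus, tanh; fold kap;
        replace (kap * 1) with kap by ring; replace (- kap * 1) with (- kap) by ring;
        replace (kap * -1) with (- kap) by ring; replace (- kap * -1) with kap by ring;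
        rewrite Es, Ec; unfold Cmult, RtoC; simpl; f_equal; field; split; auto; lra.
Qed.

(** * Inner products and completeness of the explicit basis *)

Definition continuous_components (f : R -> C) : Prop :=
  (forall x, continuous (fun y => Re (f y)) x) /\ (forall x, continuous (fun y => Im (f y)) x).

Definition continuous_bfun (f : bfun) : Prop := forall s, continuous_components (f s).

(** The bridge from the complex-valued integrals in [inner] to the real integrals in [cos_coef] and
    [sin_coef]. *)
Definition pairing (f g : R -> C) : C :=
  (RInt (fun th => Re (f th) * Re (g th) + Im (f th) * Im (g th)) 0 (2 * PI),
   RInt (fun th => Im (f th) * Re (g th) - Re (f th) * Im (g th)) 0 (2 * PI)).

Lemma RInt_pairing (f g : R -> C) : continuous_components f -> continuous_components g ->
  RInt (V := C_R_CompleteNormedModule) (fun th => f th * Cconj (g th))%C 0 (2 * PI)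
    = pairing f g.
Proof.
  intros [Hf1 Hf2] [Hg1 Hg2].
  apply is_RInt_unique.
  apply (is_RInt_fct_extend_pair (U := R_NormedModule) (V := R_NormedModule)
           (fun th => f th * Cconj (g th))%C).
  - apply is_RInt_ext_R with (fun th => Re (f th) * Re (g th) + Im (f th) * Im (g th)).
    + intro th. unfold Re, Im; simpl. ring.
    + apply (RInt_correct (V := R_CompleteNormedModule)).
      apply (ex_RInt_continuous (V := R_CompleteNormedModule)). intros x _.
      apply (continuous_plus (fun th => Re (f th) * Re (g th)) (fun th => Im (f th) * Im (g th))).
      * exact (continuous_mult _ _ _ (Hf1 x) (Hg1 x)).
      * exact (continuous_mult _ _ _ (Hf2 x) (Hg2 x)).
  - apply is_RInt_ext_R with (fun th => Im (f th) * Re (g th) - Re (f th) * Im (g th)).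
    + intro th. unfold Re, Im; simpl. ring.
    + apply (RInt_correct (V := R_CompleteNormedModule)).
      apply (ex_RInt_continuous (V := R_CompleteNormedModule)). intros x _.
      apply (continuous_minus (fun th => Im (f th) * Re (g th)) (fun th => Re (f th) * Im (g th))).
      * exact (continuous_mult _ _ _ (Hf2 x) (Hg1 x)).
      * exact (continuous_mult _ _ _ (Hf1 x) (Hg2 x)).
Qed.

Lemma inner_pairing (f g : bfun) : continuous_bfun f -> continuous_bfun g ->
  inner f g = (pairing (f true) (g true) + pairing (f false) (g false))%C.
Proof. intros Hf Hg. unfold inner. now rewrite !RInt_pairing. Qed.

Lemma pairing_conj (f g : R -> C) : continuous_components f -> continuous_components g ->
  pairing g f = Cconj (pairing f g).
Proof.
  intros [Hf1 Hf2] [Hg1 Hg2]. unfold pairing, Cconj; simpl. f_equal.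
  - apply RInt_ext_R. intros; ring.
  - symmetry.
    rewrite <- (RInt_opp (V := R_CompleteNormedModule)).
    + apply RInt_ext_R. intros. unfold opp; cbn -[Re Im]. ring.
    + apply (ex_RInt_continuous (V := R_CompleteNormedModule)). intros x _.
      apply (continuous_minus (fun th => Im (f th) * Re (g th)) (fun th => Re (f th) * Im (g th))).
      * exact (continuous_mult _ _ _ (Hf2 x) (Hg1 x)).
      * exact (continuous_mult _ _ _ (Hf1 x) (Hg2 x)).
Qed.

Lemma Cmod_inner_sym (f g : bfun) : continuous_bfun f -> continuous_bfun g ->
  Cmod (inner g f) = Cmod (inner f g).
Proof.
  intros Hf Hg. rewrite !inner_pairing, (pairing_conj (f true)), (pairing_conj (f false)) by auto.
  rewrite <- Cplus_conj. apply Cmod_conj.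
Qed.

Lemma smooth_bfun_continuous (f : bfun) : smooth_bfun f -> continuous_bfun f.
Proof.
  intros Hf s. destruct (periodic_smooth_bfun f s Hf) as [Ha Hb].
  split; [exact (periodic_smooth_continuous _ Ha)|exact (periodic_smooth_continuous _ Hb)].
Qed.

Lemma DN_smooth_bfun (nu : R) (f g : bfun) : DN nu f g -> smooth_bfun f.
Proof.
  intros [u [Hu [Hp [_ [Hf _]]]]]. now apply smooth_bfun_slice with u.
Qed.

Definition mode_weight (plus s : bool) : R := boundary_sign plus s / sqrt (4 * PI).

Lemma pairing_boundary_mode (g : R -> C) (plus s : bool) (k : Z) : continuous_components g ->
  pairing g (boundary_mode plus k s) = (RtoC (mode_weight plus s) * fourier k g)%C.
Proof.
  intros [Ha Hb]. unfold pairing, boundary_mode, fourier, Cmult, RtoC.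
  fold (mode_weight plus s). set (w := mode_weight plus s).
  assert (A1 := is_RInt_cos_coef _ (IZR k) Ha). assert (B1 := is_RInt_sin_coef _ (IZR k) Ha).
  assert (A2 := is_RInt_cos_coef _ (IZR k) Hb). assert (B2 := is_RInt_sin_coef _ (IZR k) Hb).
  cbn [fst snd Re Im]. f_equal; apply is_RInt_unique.
  - match goal with |- is_RInt _ _ _ ?v => replace v with
      (w * cos_coef (fun x => Re (g x)) (IZR k) + w * sin_coef (fun x => Im (g x)) (IZR k))
      by ring end.
    eapply is_RInt_ext_R; [|exact (is_RInt_lin _ _ w w _ _ _ _ A1 B2)].
    intro x; cbv beta. unfold Re, Im; simpl. ring.
  - match goal with |- is_RInt _ _ _ ?v => replace v with
      (w * cos_coef (fun x => Im (g x)) (IZR k) + - w * sin_coef (fun x => Re (g x)) (IZR k))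
      by ring end.
    eapply is_RInt_ext_R; [|exact (is_RInt_lin _ _ w (- w) _ _ _ _ A2 B1)].
    intro x; cbv beta. unfold Re, Im; simpl. ring.
Qed.

Lemma continuous_boundary_mode (plus : bool) (k : Z) : continuous_bfun (boundary_mode plus k).
Proof.
  intro s; split; intro x; unfold boundary_mode, Re, Im; simpl;
    set (w := boundary_sign plus s / sqrt (4 * PI)).
  - apply (ex_derive_continuous (fun x => w * cos (IZR k * x))). auto_derive; auto.
  - apply (ex_derive_continuous (fun x => w * sin (IZR k * x))). auto_derive; auto.
Qed.

Lemma inner_boundary_mode (f : bfun) (plus : bool) (k : Z) : continuous_bfun f ->
  inner f (boundary_mode plus k) =
    (RtoC (mode_weight plus true) * fourier k (f true)
     + RtoC (mode_weight plus false) * fourier k (f false))%C.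
Proof.
  intro Hf. rewrite inner_pairing by (auto using continuous_boundary_mode).
  now rewrite !pairing_boundary_mode by auto.
Qed.

Lemma sqrt_4PI : sqrt (4 * PI) <> 0 /\ sqrt (4 * PI) * sqrt (4 * PI) = 4 * PI.
Proof.
  assert (HP := PI_RGT_0). split.
  - assert (0 < sqrt (4 * PI)) by (apply sqrt_lt_R0; lra). lra.
  - apply sqrt_sqrt. lra.
Qed.

Lemma fourier_boundary_mode (plus s : bool) (k k' : Z) :
  fourier k' (boundary_mode plus k s) =
    RtoC (mode_weight plus s * if Z.eq_dec (k - k') 0 then 2 * PI else 0).
Proof.
  unfold fourier, boundary_mode. fold (mode_weight plus s). set (w := mode_weight plus s).
  unfold Re, Im; cbn [fst snd].
  assert (Hc : forall x : R, continuous (fun x : R => w * cos (IZR k * x)) x).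
  { intro x. apply (ex_derive_continuous (fun x => w * cos (IZR k * x))). auto_derive; auto. }
  assert (Hs : forall x : R, continuous (fun x : R => w * sin (IZR k * x)) x).
  { intro x. apply (ex_derive_continuous (fun x => w * sin (IZR k * x))). auto_derive; auto. }
  assert (C0 := is_RInt_cos_Z (k - k')). assert (S0 := is_RInt_sin_Z (k - k')).
  assert (A1 := is_RInt_cos_coef _ (IZR k') Hc). assert (B1 := is_RInt_sin_coef _ (IZR k') Hc).
  assert (A2 := is_RInt_cos_coef _ (IZR k') Hs). assert (B2 := is_RInt_sin_coef _ (IZR k') Hs).
  apply injective_projections; cbn [fst snd RtoC].
  - assert (H := is_RInt_lin _ _ 1 1 _ _ _ _ A1 B2). rewrite !Rmult_1_l in H.
    rewrite <- (is_RInt_unique _ _ _ _ H).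
    apply is_RInt_unique.
    eapply is_RInt_ext_R; [|exact (is_RInt_scal _ _ _ w _ C0)].
    intro x; cbv beta. unfold scal; simpl. unfold mult; simpl.
    rewrite minus_IZR, Rmult_minus_distr_r, cos_minus. ring.
  - assert (H := is_RInt_lin _ _ 1 (-1) _ _ _ _ A2 B1).
    replace (cos_coef (fun x => w * sin (IZR k * x)) (IZR k')
             - sin_coef (fun x => w * cos (IZR k * x)) (IZR k'))
      with (1 * cos_coef (fun x => w * sin (IZR k * x)) (IZR k')
             + -1 * sin_coef (fun x => w * cos (IZR k * x)) (IZR k')) by ring.
    rewrite <- (is_RInt_unique _ _ _ _ H).
    apply is_RInt_unique.
    assert (S1 := is_RInt_scal _ _ _ w _ S0).
    change (scal w 0) with (w * 0) in S1. rewrite Rmult_0_r in S1.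
    eapply is_RInt_ext_R; [|exact S1].
    intro x; cbv beta. unfold scal; simpl. unfold mult; simpl.
    rewrite minus_IZR, Rmult_minus_distr_r, sin_minus. ring.
Qed.

Lemma inner_boundary_modes (p p' : bool) (k k' : Z) :
  inner (boundary_mode p k) (boundary_mode p' k') =
    RtoC (if (Bool.eqb p p' && (k =? k')%Z)%bool then 1 else 0).
Proof.
  rewrite inner_boundary_mode by apply continuous_boundary_mode.
  rewrite !fourier_boundary_mode, <- !RtoC_mult, <- RtoC_plus. f_equal.
  destruct sqrt_4PI as [H1 H2]. assert (HP := PI_neq0).
  unfold mode_weight, boundary_sign, side.
  (* Each of the two circles contributes 1/2 in absolute value: the contributions add for equal
     parities and cancel for different ones. *)
  assert (E : / sqrt (4 * PI) * / sqrt (4 * PI) * (2 * PI) = 1 / 2).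
  { rewrite <- Rinv_mult, H2. field; auto. }
  set (q := / sqrt (4 * PI)) in *.
  destruct (Z.eq_dec (k - k') 0) as [Hk|Hk].
  - replace (k =? k')%Z with true by (symmetry; apply Z.eqb_eq; lia).
    destruct p, p'; unfold Rdiv; fold q; simpl; lra.
  - replace (k =? k')%Z with false by (symmetry; apply Z.eqb_neq; lia).
    rewrite Bool.andb_false_r. ring.
Qed.

Definition lin_comb (a b : R) (f g : R -> C) : R -> C :=
  fun th => (RtoC a * f th + RtoC b * g th)%C.

Lemma Re_lin_comb (a b : R) (f g : R -> C) (x : R) :
  Re (lin_comb a b f g x) = a * Re (f x) + b * Re (g x).
Proof. unfold lin_comb, Re, RtoC; simpl. ring. Qed.

Lemma Im_lin_comb (a b : R) (f g : R -> C) (x : R) :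
  Im (lin_comb a b f g x) = a * Im (f x) + b * Im (g x).
Proof. unfold lin_comb, Im, RtoC; simpl. ring. Qed.

Lemma fourier_lin_comb (a b : R) (f g : R -> C) (k : Z) :
  continuous_components f -> continuous_components g ->
  fourier k (lin_comb a b f g) = (RtoC a * fourier k f + RtoC b * fourier k g)%C.
Proof.
  intros [Hf1 Hf2] [Hg1 Hg2]. unfold fourier.
  rewrite (functional_extensionality _ _ (Re_lin_comb a b f g)),
    (functional_extensionality _ _ (Im_lin_comb a b f g)).
  rewrite !cos_coef_lin, !sin_coef_lin by auto.
  unfold Cmult, Cplus, RtoC; simpl. f_equal; ring.
Qed.

(** For a fixed parity, the inner product with a mode is one Fourier coefficient of a fixed
    combination of the two boundary components, so the scalar identity [parseval] applies to that
    combination. *)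
Lemma boundary_mode_parseval (f : bfun) (plus : bool) : smooth_bfun f ->
  is_series (fun n => Cmod (inner f (boundary_mode plus (int_enum n))) ^ 2)
    (2 * PI * (RInt (fun x =>
        (mode_weight plus true * Re (f true x) + mode_weight plus false * Re (f false x)) ^ 2
        + (mode_weight plus true * Im (f true x) + mode_weight plus false * Im (f false x)) ^ 2)
      0 (2 * PI))).
Proof.
  intro Hf. assert (Hc := smooth_bfun_continuous f Hf).
  set (a := mode_weight plus true). set (b := mode_weight plus false).
  set (g := lin_comb a b (f true) (f false)).
  destruct (periodic_smooth_bfun f true Hf) as [R1 I1].
  destruct (periodic_smooth_bfun f false Hf) as [R2 I2].
  assert (HR : periodic_smooth (fun x => a * Re (f true x) + b * Re (f false x)))
    by now apply periodic_smooth_lin.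
  assert (HI : periodic_smooth (fun x => a * Im (f true x) + b * Im (f false x)))
    by now apply periodic_smooth_lin.
  assert (ER := functional_extensionality _ _ (Re_lin_comb a b (f true) (f false))).
  assert (EI := functional_extensionality _ _ (Im_lin_comb a b (f true) (f false))).
  assert (H := parseval g). unfold g in H. rewrite ER, EI in H.
  specialize (H (periodic_smooth_C1 _ HR) (periodic_smooth_C1 _ HI)).
  assert (Hsq : forall h, periodic_smooth h -> is_RInt (fun x => h x ^ 2) 0 (2 * PI)
                  (RInt (fun x => h x ^ 2) 0 (2 * PI))).
  { intros h Hh. apply (RInt_correct (V := R_CompleteNormedModule)).
    apply (ex_RInt_continuous (V := R_CompleteNormedModule)). intros x _.
    apply continuous_ext with (fun x => h x * h x); [intro; apply Rsqr_pow2|].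
    assert (Hhx := periodic_smooth_continuous h Hh x). exact (continuous_mult _ _ _ Hhx Hhx). }
  assert (Hadd : RInt (fun x => (a * Re (f true x) + b * Re (f false x)) ^ 2
                        + (a * Im (f true x) + b * Im (f false x)) ^ 2) 0 (2 * PI)
     = RInt (fun x => (a * Re (f true x) + b * Re (f false x)) ^ 2) 0 (2 * PI)
       + RInt (fun x => (a * Im (f true x) + b * Im (f false x)) ^ 2) 0 (2 * PI)).
  { apply is_RInt_unique. exact (is_RInt_plus _ _ _ _ _ _ (Hsq _ HR) (Hsq _ HI)). }
  rewrite Hadd, Rmult_plus_distr_l.
  eapply is_series_ext.
  2:{ match type of H with is_series _ (2 * PI * RInt ?F _ _ + 2 * PI * RInt ?G _ _) =>
      rewrite (RInt_ext F (fun x => (a * Re (f true x) + b * Re (f false x)) ^ 2)) in H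
        by (intros y _; now rewrite <- (Re_lin_comb a b (f true) (f false) y));
      rewrite (RInt_ext G (fun x => (a * Im (f true x) + b * Im (f false x)) ^ 2)) in H
        by (intros y _; now rewrite <- (Im_lin_comb a b (f true) (f false) y)) end.
      exact H. }
  intro n. cbv beta. rewrite inner_boundary_mode by auto.
  now rewrite fourier_lin_comb by apply Hc.
Qed.

Definition basis_index (n : nat) : bool * Z := (Nat.even n, int_enum (Nat.div2 n)).

Definition basis (n : nat) : bfun := boundary_mode (fst (basis_index n)) (snd (basis_index n)).

Definition basis_eigenvalue (nu : R) (n : nat) : R :=
  eigenvalue nu (fst (basis_index n)) (snd (basis_index n)).

Lemma basis_index_even (n : nat) : basis_index (2 * n) = (true, int_enum n).
Proof. unfold basis_index. now rewrite Nat.even_even, Nat.div2_even. Qed.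

Lemma basis_index_odd (n : nat) : basis_index (2 * n + 1) = (false, int_enum n).
Proof. unfold basis_index. now rewrite Nat.even_odd, Nat.div2_odd'. Qed.

Lemma basis_index_inj (m n : nat) : basis_index m = basis_index n -> m = n.
Proof.
  destruct (Nat.Even_or_Odd m) as [[i ->]|[i ->]];
  destruct (Nat.Even_or_Odd n) as [[j ->]|[j ->]];
  rewrite ?basis_index_even, ?basis_index_odd; intro E; try discriminate;
  injection E as E; apply int_enum_inj in E; lia.
Qed.

Lemma basis_orthonormal (m n : nat) :
  inner (basis m) (basis n) = RtoC (if Nat.eqb m n then 1 else 0).
Proof.
  unfold basis. rewrite inner_boundary_modes. f_equal.
  destruct (Nat.eqb_spec m n) as [->|Hmn].
  - now rewrite Bool.eqb_reflx, Z.eqb_refl.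
  - destruct (Bool.eqb _ _) eqn:E1; auto. destruct (Z.eqb_spec (snd (basis_index m))
      (snd (basis_index n))) as [E2|]; auto.
    exfalso. apply Hmn, basis_index_inj. apply Bool.eqb_prop in E1.
    now apply injective_projections.
Qed.

Lemma basis_parseval (f : bfun) : smooth_bfun f ->
  is_series (fun n => Cmod (inner f (basis n)) ^ 2) (Re (inner f f)).
Proof.
  intro Hf. assert (Hc := smooth_bfun_continuous f Hf).
  set (I := fun plus => 2 * PI * RInt (fun x =>
        (mode_weight plus true * Re (f true x) + mode_weight plus false * Re (f false x)) ^ 2
        + (mode_weight plus true * Im (f true x) + mode_weight plus false * Im (f false x)) ^ 2)
      0 (2 * PI)).
  assert (HI : Re (inner f f) = I true + I false).
  { rewrite inner_pairing by auto. unfold pairing, Re at 1, Cplus. cbn [fst snd].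
    assert (Hint : forall a b : R, ex_RInt (fun x =>
        (a * Re (f true x) + b * Re (f false x)) ^ 2
        + (a * Im (f true x) + b * Im (f false x)) ^ 2) 0 (2 * PI)).
    { intros a b. apply (ex_RInt_continuous (V := R_CompleteNormedModule)). intros x _.
      destruct (Hc true) as [Ht1 Ht2]. destruct (Hc false) as [Hf1 Hf2].
      assert (Hl : forall h1 h2 : R -> R, continuous h1 x -> continuous h2 x ->
        continuous (fun x => (a * h1 x + b * h2 x) ^ 2) x).
      { intros h1 h2 H1 H2.
        assert (H3 : continuous (fun x => a * h1 x + b * h2 x) x).
        { exact (continuous_plus _ _ _ (continuous_scal_r a h1 x H1)
                   (continuous_scal_r b h2 x H2)). }
        apply continuous_ext with (fun x => (a * h1 x + b * h2 x) * (a * h1 x + b * h2 x));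
          [intro; apply Rsqr_pow2|]. exact (continuous_mult _ _ _ H3 H3). }
      exact (continuous_plus _ _ _ (Hl _ _ (Ht1 x) (Hf1 x)) (Hl _ _ (Ht2 x) (Hf2 x))). }
    assert (Hsq : forall s, is_RInt (fun th => Re (f s th) * Re (f s th) + Im (f s th) * Im (f s th))
       0 (2 * PI) (RInt (fun th => Re (f s th) * Re (f s th) + Im (f s th) * Im (f s th)) 0 (2 * PI))).
    { intro s. apply (RInt_correct (V := R_CompleteNormedModule)).
      apply (ex_RInt_continuous (V := R_CompleteNormedModule)). intros x _.
      destruct (Hc s) as [Ht1 Ht2].
      exact (continuous_plus _ _ _ (continuous_mult _ _ _ (Ht1 x) (Ht1 x))
               (continuous_mult _ _ _ (Ht2 x) (Ht2 x))). }
    assert (J := fun plus => RInt_correct (V := R_CompleteNormedModule) _ _ _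
                   (Hint (mode_weight plus true) (mode_weight plus false))).
    assert (HJ := is_RInt_lin _ _ (2 * PI) (2 * PI) _ _ _ _ (J true) (J false)).
    assert (HS := is_RInt_lin _ _ 1 1 _ _ _ _ (Hsq true) (Hsq false)).
    rewrite !Rmult_1_l in HS.
    unfold I. rewrite <- (is_RInt_unique _ _ _ _ HS), <- (is_RInt_unique _ _ _ _ HJ).
    apply RInt_ext_R. intros x.
    unfold mode_weight, boundary_sign, side.
    destruct sqrt_4PI as [H1 H2].
    assert (E : / sqrt (4 * PI) * / sqrt (4 * PI) * (4 * PI) = 1).
    { rewrite <- Rinv_mult, H2. field. apply PI_neq0. }
    unfold Rdiv. set (q := / sqrt (4 * PI)) in *.
    set (a := Re (f true x)). set (b := Re (f false x)).
    set (c := Im (f true x)). set (d := Im (f false x)).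
    (* The parallelogram law: the difference and the sum of the two components together recover both
       squared moduli, with total weight 4 PI q^2 = 1. *)
    transitivity (q * q * (4 * PI) * (a * a + c * c + (b * b + d * d))); [rewrite E|]; ring. }
  rewrite HI. apply is_series_even_odd.
  - eapply is_series_ext; [|exact (boundary_mode_parseval f true Hf)].
    intro n. cbv beta. unfold basis. now rewrite basis_index_even.
  - eapply is_series_ext; [|exact (boundary_mode_parseval f false Hf)].
    intro n. cbv beta. unfold basis. now rewrite basis_index_odd.
Qed.

Lemma eigenbasis_basis (nu : R) : 0 < nu < 1 ->
  eigenbasis nu (basis_eigenvalue nu) basis.
Proof.
  intro Hnu. repeat split.
  - intro n. apply DN_boundary_mode. now apply IZR_sub_nz.
  - apply basis_orthonormal.
  - apply basis_parseval.
Qed.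

(** Takes the place of the symmetry of the operator in the comparison of eigenbases. *)
Lemma eigen_inner_basis (nu lam : R) (phi : bfun) (n : nat) : 0 < nu < 1 ->
  DN nu phi (fun s th => RtoC lam * phi s th)%C ->
  lam = basis_eigenvalue nu n \/ inner phi (basis n) = RtoC 0.
Proof.
  intros Hnu HD.
  assert (Hc := smooth_bfun_continuous _ (DN_smooth_bfun _ _ _ HD)).
  destruct (Req_dec lam (basis_eigenvalue nu n)) as [|Hne]; auto. right.
  unfold basis. rewrite inner_boundary_mode by auto.
  unfold basis_eigenvalue in Hne.
  set (k := snd (basis_index n)) in *.
  destruct (DN_eigen_fourier nu lam phi k HD) as [H1 H2].
  destruct (fst (basis_index n)); unfold eigenvalue in Hne.
  - rewrite (H1 Hne (IZR_sub_nz nu k Hnu)).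
    rewrite <- Cmult_plus_distr_r, <- RtoC_plus.
    replace (mode_weight true true + mode_weight true false) with 0
      by (unfold mode_weight, boundary_sign, side, Rdiv; ring).
    ring.
  - rewrite (H2 Hne).
    replace (mode_weight false true) with (mode_weight false false) by reflexivity.
    ring.
Qed.

(** * The heat trace *)

Lemma eigenbasis_heat_sum (nu t T : R) (lam : nat -> R) (phi : nat -> bfun) :
  0 < nu < 1 -> eigenbasis nu lam phi ->
  is_series (fun n => exp (- t * basis_eigenvalue nu n)) T ->
  is_series (fun n => exp (- t * lam n)) T.
Proof.
  intros Hnu [HD [Ho HP]] HT.
  destruct (eigenbasis_basis nu Hnu) as [HDb [Hob HPb]].
  assert (Hs : forall n, smooth_bfun (phi n)) by (intro n; exact (DN_smooth_bfun _ _ _ (HD n))).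
  assert (Hsb : forall n, smooth_bfun (basis n)) by (intro n; exact (DN_smooth_bfun _ _ _ (HDb n))).
  assert (H1 : forall n, Re (inner (phi n) (phi n)) = 1).
  { intro n. now rewrite Ho, Nat.eqb_refl. }
  assert (H1b : forall n, Re (inner (basis n) (basis n)) = 1).
  { intro n. now rewrite Hob, Nat.eqb_refl. }
  apply (is_series_nonneg_swap
    (fun n j => exp (- t * basis_eigenvalue nu j) * Cmod (inner (phi n) (basis j)) ^ 2)
    (fun j => exp (- t * basis_eigenvalue nu j))).
  - intros n j. apply Rmult_le_pos; [left; apply exp_pos|apply pow2_ge_0].
  - intro j. assert (H := HP _ (Hsb j)). rewrite H1b in H.
    assert (H2 := is_series_scal (exp (- t * basis_eigenvalue nu j)) _ _ H).
    change (scal ?x 1) with (x * 1) in H2. rewrite Rmult_1_r in H2.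
    eapply is_series_ext; [|exact H2].
    intro n. cbv beta. change (scal ?x ?y) with (x * y).
    now rewrite Cmod_inner_sym by (apply smooth_bfun_continuous; auto).
  - exact HT.
  - intro n. assert (H := HPb _ (Hs n)). rewrite H1 in H.
    assert (H2 := is_series_scal (exp (- t * lam n)) _ _ H).
    change (scal ?x 1) with (x * 1) in H2. rewrite Rmult_1_r in H2.
    eapply is_series_ext; [|exact H2].
    intro j. cbv beta. change (scal ?x ?y) with (x * y).
    (* Either the two eigenvalues agree or the coefficient vanishes; in both cases the weight with
       [basis_eigenvalue nu j] equals the weight with [lam n]. *)
    destruct (eigen_inner_basis nu (lam n) (phi n) j Hnu (HD n)) as [->|E]; auto.
    rewrite E, Cmod_0, pow_i, !Rmult_0_r; auto.
Qed.

Lemma is_heat_trace_basis (nu t T : R) : 0 < nu < 1 ->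
  is_series (fun n => exp (- t * basis_eigenvalue nu n)) T -> is_heat_trace nu t T.
Proof.
  intros Hnu HT. split.
  - exists (basis_eigenvalue nu), basis. now apply eigenbasis_basis.
  - intros lam phi H. exact (eigenbasis_heat_sum nu t T lam phi Hnu H HT).
Qed.

(** The existence clause of [is_heat_trace] supplies an eigenbasis on which both values are sums of
    the same series. *)
Lemma is_heat_trace_unique (nu t T T' : R) :
  is_heat_trace nu t T -> is_heat_trace nu t T' -> T = T'.
Proof.
  intros [[lam [phi H]] HT] [_ HT'].
  rewrite <- (is_series_unique _ _ (HT _ _ H)).
  exact (is_series_unique _ _ (HT' _ _ H)).
Qed.

(** * The coefficients and the final expansion *)

Lemma a_coef_0 (lambda : R -> Z -> R) (nu : R) : a_coef lambda nu 0 = 0.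
Proof.
  unfold a_coef, Series_Z.
  (* Written as a product so that the factor 0 can be pulled out of the series. *)
  assert (E : forall k, a_term lambda nu 0 k = 0 * 0) by (intro; unfold a_term; simpl; ring).
  rewrite (Series_ext (fun n => a_term lambda nu 0 (Z.of_nat n)) _ (fun n => E _)),
    (Series_ext (fun n => a_term lambda nu 0 (- Z.of_nat (S n))%Z) _ (fun n => E _)).
  rewrite !(Series_scal_l 0). ring.
Qed.

Lemma Series_Z_plus (a b : Z -> R) : ex_series_Z a -> ex_series_Z b ->
  ex_series_Z (fun k => a k + b k) /\
  Series_Z (fun k => a k + b k) = Series_Z a + Series_Z b.
Proof.
  intros [A1 A2] [B1 B2]. split; [split|].
  - exact (ex_series_plus _ _ A1 B1).
  - exact (ex_series_plus _ _ A2 B2).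
  - unfold Series_Z. rewrite !Series_plus by auto. ring.
Qed.

(** The origin of the argument 2 |k - nu| in [breve_term]: adding the two families doubles the
    angle. *)
Lemma tanh_add_coth (m : R) : 0 < m -> tanh m + coth m = 2 * coth (2 * m).
Proof.
  intro Hm. assert (Hs := sinh_pos m Hm). assert (Hc := cosh_pos m).
  assert (Es : sinh (2 * m) = 2 * sinh m * cosh m).
  { unfold sinh, cosh. replace (2 * m) with (m + m) by ring.
    replace (- (m + m)) with (- m + - m) by ring. rewrite !exp_plus. field. }
  assert (Ec : cosh (2 * m) = sinh m ^ 2 + cosh m ^ 2).
  { unfold sinh, cosh. replace (2 * m) with (m + m) by ring.
    replace (- (m + m)) with (- m + - m) by ring. rewrite !exp_plus.
    assert (exp m * exp (- m) = 1) by (rewrite <- exp_plus, Rplus_opp_r; apply exp_0).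
    nra. }
  unfold tanh, coth. rewrite Es, Ec. field. lra.
Qed.

Lemma breve_term_eq (nu : R) (k : Z) : 0 < nu < 1 ->
  a_term lambda_plus nu 1 k + a_term lambda_minus nu 1 k = 2 * breve_term nu k.
Proof.
  intro Hnu. unfold a_term, breve_term.
  rewrite lambda_plus_Rabs, lambda_minus_Rabs, !pow_1.
  assert (Hm := Rabs_pos_lt _ (IZR_sub_nz nu k Hnu)). set (m := Rabs _) in *.
  assert (H := tanh_add_coth m Hm).
  replace (coth (2 * m)) with ((tanh m + coth m) / 2) by lra. field.
Qed.

Lemma breve_series (nu : R) : 0 < nu < 1 ->
  ex_series_Z (breve_term nu) /\ a_plus nu 1 + a_minus nu 1 = -2 * a1_breve nu.
Proof.
  intro Hnu. assert (Ht : 0 < 1 < 2) by lra.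
  destruct (Z_power_series _ nu 1 Hnu (close_to_abs_plus nu Hnu) Ht) as [P _].
  destruct (Z_power_series _ nu 1 Hnu (close_to_abs_minus nu Hnu) Ht) as [M _].
  destruct (Series_Z_plus _ _ (P 1%nat) (M 1%nat)) as [[E1 E2] E3].
  assert (Hb : forall k, scal (/ 2) (a_term lambda_plus nu 1 k + a_term lambda_minus nu 1 k)
             = breve_term nu k).
  { intro k. rewrite breve_term_eq by auto. unfold scal; simpl. unfold mult; simpl. field. }
  split; [split|].
  - eapply ex_series_ext; [|exact (ex_series_scal (V := R_NormedModule) (/ 2) _ E1)].
    intro n; cbv beta. apply Hb.
  - eapply ex_series_ext; [|exact (ex_series_scal (V := R_NormedModule) (/ 2) _ E2)].
    intro n; cbv beta. apply Hb.
  - unfold a_plus, a_minus, a_coef.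
    replace (a1_breve nu) with
      (/ 2 * Series_Z (fun k => a_term lambda_plus nu 1 k + a_term lambda_minus nu 1 k)).
    + rewrite E3. simpl. field.
    + unfold a1_breve, Series_Z. rewrite Rmult_plus_distr_l, <- !Series_scal_l.
      f_equal; apply Series_ext; intro n; apply Hb.
Qed.

Lemma heat_trace_power_series (nu t : R) : 0 < nu < 1 -> 0 < t < 2 ->
  ex_series (fun n => Rabs ((a_plus nu (S n) + a_minus nu (S n)) * t ^ S n)) /\
  is_heat_trace nu t
    (2 * (cosh (t * (nu - 1 / 2)) / sinh (t / 2)) +
     Series (fun n => (a_plus nu (S n) + a_minus nu (S n)) * t ^ S n)).
Proof.
  intros Hnu Ht.
  assert (Fp := close_to_abs_plus nu Hnu). assert (Fm := close_to_abs_minus nu Hnu).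
  destruct (Z_power_series _ nu t Hnu Fp Ht) as [_ [_ [P3 P4]]].
  destruct (Z_power_series _ nu t Hnu Fm Ht) as [_ [_ [M3 M4]]].
  destruct (Series_Z_heat _ nu t Hnu Fp Ht) as [HP1 HP2].
  destruct (Series_Z_heat _ nu t Hnu Fm Ht) as [HM1 HM2].
  assert (Hex : ex_series (fun n => Rabs ((a_plus nu n + a_minus nu n) * t ^ n))).
  { apply (ex_series_le (V := R_CompleteNormedModule) _ _) with (2 := ex_series_plus _ _ P3 M3).
    intro n. change (norm ?x) with (Rabs x). rewrite Rabs_Rabsolu, Rmult_plus_distr_r.
    apply Rabs_triang. }
  split; [now apply (proj1 (ex_series_incr_1 _)) in Hex|].
  apply is_heat_trace_basis; auto.
  assert (Hsum : Series (fun n => (a_plus nu (S n) + a_minus nu (S n)) * t ^ S n)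
     = Series_Z (heat_diff lambda_plus nu t) + Series_Z (heat_diff lambda_minus nu t)).
  (* The expansions of the two differences start at p = 0, the stated series at p = 1; the
     coefficient of order 0 vanishes, so the sums agree. *)
  { apply is_series_unique.
    apply (is_series_incr_1 (fun n => (a_plus nu n + a_minus nu n) * t ^ n)).
    unfold a_plus at 2, a_minus at 2. rewrite !a_coef_0.
    change (plus ?x ?y) with (x + y). rewrite Rplus_0_r, Rmult_0_l, Rplus_0_r.
    eapply is_series_ext; [|exact (is_series_plus _ _ _ _ P4 M4)].
    intro n. cbv beta. change (plus ?x ?y) with (x + y). unfold a_plus, a_minus.
    symmetry. apply Rmult_plus_distr_r. }
  rewrite Hsum.
  match goal with |- is_series _ ?l => replace l with
    (Series_Z (fun k => exp (- t * lambda_plus nu k))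
     + Series_Z (fun k => exp (- t * lambda_minus nu k))) by (rewrite HP2, HM2; ring) end.
  apply is_series_even_odd.
  - eapply is_series_ext; [|exact (is_series_int_enum _ HP1)].
    intro n. cbv beta. unfold basis_eigenvalue. now rewrite basis_index_even.
  - eapply is_series_ext; [|exact (is_series_int_enum _ HM1)].
    intro n. cbv beta. unfold basis_eigenvalue. now rewrite basis_index_odd.
Qed.

(** The terms after the first have t^2 as a common factor, and the remaining powers of t are at most
    1. Absolute convergence at the point 1, inside the radius 2, thus yields a constant independent
    of t. *)
Lemma power_series_tail_2 (c : nat -> R) (t : R) : 0 < t <= 1 ->
  ex_series (fun n => Rabs (c n)) ->
  Rabs (Series (fun n => c n * t ^ S n) - c 0%nat * t)
    <= Series (fun n => Rabs (c (S n))) * t ^ 2.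
Proof.
  intros Ht Hc.
  assert (Hc1 : ex_series (fun n => Rabs (c (S n)))) by now apply (proj1 (ex_series_incr_1 _)) in Hc.
  assert (Hy : forall y n, Rabs (y * t ^ n) <= Rabs y).
  { intros y n. rewrite Rabs_mult, (Rabs_pos_eq (t ^ n)) by (apply pow_le; lra).
    assert (Ht1 : t ^ n <= 1) by (rewrite <- (pow1 n); apply pow_incr; lra).
    assert (Hp := Rabs_pos y). nra. }
  assert (Hex : ex_series (fun n => c n * t ^ n)).
  { apply (ex_series_le (V := R_CompleteNormedModule) _ _ (fun n => Hy _ n) Hc). }
  assert (Hexa : ex_series (fun n => Rabs (c (S n) * t ^ n))).
  { apply (ex_series_le (V := R_CompleteNormedModule) _ (fun n => Rabs (c (S n)))); auto.
    intro n. change (norm ?x) with (Rabs x). rewrite Rabs_Rabsolu. apply Hy. }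
  replace (Series (fun n => c n * t ^ S n) - c 0%nat * t)
    with (t ^ 2 * Series (fun n => c (S n) * t ^ n)).
  - rewrite Rabs_mult, (Rabs_pos_eq (t ^ 2)) by (apply pow_le; lra).
    rewrite Rmult_comm. apply Rmult_le_compat_r; [apply pow_le; lra|].
    apply Rle_trans with (1 := Series_Rabs _ Hexa).
    apply Series_le; auto. intro n; split; [apply Rabs_pos|apply Hy].
  - rewrite <- Series_scal_l.
    rewrite (Series_ext (fun n => c n * t ^ S n) (fun n => t * (c n * t ^ n)))
      by (intro; simpl; ring).
    rewrite (Series_scal_l t), (Series_incr_1 _ Hex), Rmult_plus_distr_l.
    rewrite <- (Series_scal_l t).
    rewrite (Series_ext (fun n => t ^ 2 * (c (S n) * t ^ n)) (fun n => t * (c (S n) * t ^ S n)))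
      by (intro; simpl; ring).
    simpl. ring.
Qed.

Theorem mainTheorem6 (nu : R) (hnu : 0 < nu < 1) :
  (forall p : nat, (1 <= p)%nat ->
     ex_series_Z (a_term lambda_plus nu p) /\
     ex_series_Z (a_term lambda_minus nu p)) /\
  (forall t : R, 0 < t < 2 ->
     ex_series (fun n => (a_plus nu (S n) + a_minus nu (S n)) * t ^ S n) /\
     is_heat_trace nu t
       (2 * (cosh (t * (nu - 1 / 2)) / sinh (t / 2)) +
        Series (fun n => (a_plus nu (S n) + a_minus nu (S n)) * t ^ S n))) /\
  ex_series_Z (breve_term nu) /\
  (exists K d : R, 0 < d /\
     forall t T : R, 0 < t < d -> is_heat_trace nu t T ->
       Rabs (T - (4 / t + 2 * (1 / 6 - nu + nu ^ 2 - a1_breve nu) * t))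
         <= K * t ^ 2).
Proof.
  (* The summability of [a_term] and [breve_term] does not involve t; it is read off from the
     expansion at t = 1. *)
  assert (H1 : 0 < 1 < 2) by lra.
  destruct (breve_series nu hnu) as [Hb1 Hb2].
  repeat split.
  - apply (Z_power_series _ nu 1 hnu (close_to_abs_plus nu hnu) H1).
  - apply (Z_power_series _ nu 1 hnu (close_to_abs_plus nu hnu) H1).
  - apply (Z_power_series _ nu 1 hnu (close_to_abs_minus nu hnu) H1).
  - apply (Z_power_series _ nu 1 hnu (close_to_abs_minus nu hnu) H1).
  - apply ex_series_Rabs. now apply heat_trace_power_series.
  - exists (basis_eigenvalue nu), basis. now apply eigenbasis_basis.
  - now apply (proj2 (heat_trace_power_series nu t hnu H)).
  - apply Hb1.
  - apply Hb1.
  - set (c := fun n => a_plus nu (S n) + a_minus nu (S n)).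
    assert (Hc : ex_series (fun n => Rabs (c n))).
    { eapply ex_series_ext; [|exact (proj1 (heat_trace_power_series nu 1 hnu H1))].
      intro n. cbv beta. now rewrite pow1, Rmult_1_r. }
    (* The 4 bounds the error of the hyperbolic quotient and the series bounds the terms of order at
       least 2; both estimates are valid for t < 1. *)
    exists (4 + Series (fun n => Rabs (c (S n)))), 1. split; [lra|].
    intros t T Ht HT.
    rewrite (is_heat_trace_unique nu t _ _ HT
               (proj2 (heat_trace_power_series nu t hnu ltac:(lra)))).
    assert (Hb : Rabs (nu - 1 / 2) <= 1 / 2) by (apply Rabs_le; lra).
    assert (B1 := cosh_div_sinh_asymptotics (nu - 1 / 2) t Hb Ht).
    assert (B2 := power_series_tail_2 c t ltac:(lra) Hc).
    unfold c at 2 in B2. rewrite Hb2 in B2. fold c.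
    change (Series (fun n => (a_plus nu (S n) + a_minus nu (S n)) * t ^ S n))
      with (Series (fun n => c n * t ^ S n)).
    rewrite Rmult_plus_distr_r.
    eapply Rle_trans; [|exact (Rplus_le_compat _ _ _ _ B1 B2)].
    eapply Rle_trans; [|apply Rabs_triang].
    assert (Hs := sinh_pos (t / 2) ltac:(lra)).
    (* With b = nu - 1/2, the coefficient 2 b^2 - 1/6 equals 2 (1/6 - nu + nu^2). *)
    right. f_equal. field. lra.
Qed.
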